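(* Let $\mathcal F$ be a family of graphs such that either $\mathcal F$ contains some bipartite graph $F$ having a vertex $v$ for which $F-v$ is a forest, or $\mathrm{ex}(n,\mathcal F)=O(n)$. Let $k\ge1$ be an integer and suppose that for all $n$ large enough, $\mathrm{SPEX}(n,\mathcal F)$ contains $H$, where either (a) $H=K_k+\overline{K_{n-k}}$, or (b) $H=K_k+(K_2\cup\overline{K_{n-k-2}})$. Then for any $\alpha\in(0,1)$, for all $n$ large enough, $\mathrm{SPEX}_\alpha(n,\mathcal F)=\{H\}$.
   Context: A graph is $\mathcal F$-free if it contains no member of $\mathcal F$ as a subgraph; $\mathrm{ex}(n,\mathcal F)$ is the maximum number of edges of an $n$-vertex $\mathcal F$-free graph. For a graph $G$ with adjacency matrix $A$ and diagonal degree matrix $D$, and $\alpha\in[0,1)$, let $A_\alpha(G)=\alpha D+(1-\alpha)A$ and $\lambda_\alpha(G)$ its largest eigenvalue. $\mathrm{SPEX}(n,\mathcal F)$ (resp. $\mathrm{SPEX}_\alpha(n,\mathcal F)$) is the set of $n$-vertex $\mathcal F$-free graphs maximizing $\lambda_0$ (resp. $\lambda_\alpha$) among $n$-vertex $\mathcal F$-free graphs. $G+H$ is the join, $\cup$ disjoint union, $\overline{G}$ complement. *)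

(* Defs.v *)
From HB Require Import structures.
From mathcomp Require Import all_boot all_order all_algebra.
From mathcomp Require Import all_classical all_reals all_analysis.

Set Implicit Arguments.
Unset Strict Implicit.
Unset Printing Implicit Defensive.

Import Order.TTheory GRing.Theory Num.Theory.
Import numFieldNormedType.Exports.

Local Open Scope classical_set_scope.
Local Open Scope ring_scope.

Record sgraph := SGraph {
  vertex :> finType;
  edge : rel vertex;
  edge_sym : symmetric edge;
  edge_irr : irreflexive edge
}.

Arguments edge {s} x y.

Section Constructions.

Lemma complete_sym (n : nat) : symmetric (fun x y : 'I_n => x != y).
Proof. by move=> x y; rewrite eq_sym. Qed.

Lemma complete_irr (n : nat) : irreflexive (fun x y : 'I_n => x != y).
Proof. by move=> x; rewrite eqxx. Qed.

Definition complete_graph (n : nat) : sgraph :=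
  SGraph (@complete_sym n) (@complete_irr n).

Definition compl_edge (G : sgraph) : rel G :=
  fun x y => (x != y) && ~~ edge x y.

Lemma compl_sym (G : sgraph) : symmetric (@compl_edge G).
Proof. by move=> x y; rewrite /compl_edge eq_sym edge_sym. Qed.

Lemma compl_irr (G : sgraph) : irreflexive (@compl_edge G).
Proof. by move=> x; rewrite /compl_edge eqxx. Qed.

Definition graph_compl (G : sgraph) : sgraph :=
  SGraph (@compl_sym G) (@compl_irr G).

(* [b] tells whether vertices in different components are adjacent. *)
Definition sum_edge (b : bool) (G H : sgraph) : rel (G + H)%type :=
  fun u v => match u, v with
    | inl x, inl y => edge x y
    | inr x, inr y => edge x y
    | _, _ => b
    end.

Lemma sum_sym b (G H : sgraph) : symmetric (@sum_edge b G H).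
Proof. by case=> x [] y //=; rewrite edge_sym. Qed.

Lemma sum_irr b (G H : sgraph) : irreflexive (@sum_edge b G H).
Proof. by case=> x /=; rewrite edge_irr. Qed.

Definition disjoint_union (G H : sgraph) : sgraph :=
  SGraph (@sum_sym false G H) (@sum_irr false G H).

Definition graph_join (G H : sgraph) : sgraph :=
  SGraph (@sum_sym true G H) (@sum_irr true G H).

Definition delete_edge (G : sgraph) (v : G) : rel {x : G | x != v} :=
  fun x y => edge (val x) (val y).

Lemma delete_sym (G : sgraph) (v : G) : symmetric (@delete_edge G v).
Proof. by move=> x y; rewrite /delete_edge edge_sym. Qed.

Lemma delete_irr (G : sgraph) (v : G) : irreflexive (@delete_edge G v).
Proof. by move=> x; rewrite /delete_edge edge_irr. Qed.

Definition delete_vertex (G : sgraph) (v : G) : sgraph :=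
  SGraph (@delete_sym G v) (@delete_irr G v).

End Constructions.

Definition isomorphic (G H : sgraph) : Prop :=
  exists2 f : G -> H, bijective f & forall x y, edge (f x) (f y) = edge x y.

(* Subgraphs need not be induced. *)
Definition contains_graph (G F : sgraph) : Prop :=
  exists2 f : F -> G, injective f & forall x y, edge x y -> edge (f x) (f y).

(* [sgraph -> Prop] rather than [set sgraph]: [sgraph] quantifies over all
   finite types and is too large for the universe of [set]. *)
Definition graph_family := sgraph -> Prop.

Definition family_free (F : graph_family) (G : sgraph) : Prop :=
  forall F0, F F0 -> ~ contains_graph G F0.

Definition bipartite (G : sgraph) : Prop :=
  exists c : G -> bool, forall x y, edge x y -> c x != c y.

(* [ucycle] also accepts the empty sequence and, since [edge] is symmetric,
   the two ends of an edge; these are not graph cycles. *)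
Definition forest (G : sgraph) : Prop :=
  forall s : seq G, (2 < size s)%N -> ~ ucycle edge s.

Definition edge_set (G : sgraph) : {set {set G}} :=
  [set e : {set G} | [exists x, exists y, edge x y && (e == [set x; y])]]%SET.

(* The bound on [m] loses nothing: a graph on [n] vertices has at most
   ['C(n, 2)] edges. The value is 0 when no such graph is [F]-free. *)
Definition ex_number (n : nat) (F : graph_family) : nat :=
  \max_(m < ('C(n, 2)).+1 |
    `[< exists G : sgraph, [/\ #|G| = n, family_free F G & #|edge_set G| = m] >]) m.

Section Spectral.
Variable R : realType.

Definition adjacency (G : sgraph) : 'M[R]_#|G| :=
  \matrix_(i, j) (edge (enum_val i) (enum_val j))%:R.

Definition vertex_degree (G : sgraph) (x : G) : nat := #|[set y | edge x y]%SET|.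

Definition degree_mx (G : sgraph) : 'M[R]_#|G| :=
  diag_mx (\row_i (vertex_degree (enum_val i))%:R).

Definition A_ (alpha : R) (G : sgraph) : 'M[R]_#|G| :=
  alpha *: degree_mx G + (1 - alpha) *: adjacency G.

(* The supremum is a maximum when [G] has a vertex, the spectrum of a real
   symmetric matrix being finite and nonempty. *)
Definition lambda_ (alpha : R) (G : sgraph) : R :=
  sup [set a | eigenvalue (A_ alpha G) a].

(* As a class of graphs, closed under isomorphism. *)
Definition SPEX_ (alpha : R) (n : nat) (F : graph_family) : graph_family :=
  fun G => [/\ #|G| = n, family_free F G &
    forall G' : sgraph, #|G'| = n -> family_free F G' ->
      lambda_ alpha G' <= lambda_ alpha G].

Definition SPEX (n : nat) (F : graph_family) : graph_family := SPEX_ 0 n F.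

End Spectral.

(* Main.v *)
Require Import Defs.
From HB Require Import structures.
From mathcomp Require Import all_boot all_order all_algebra.
From mathcomp Require Import all_classical all_reals all_analysis.
From mathcomp Require Import ring lra.

Set Implicit Arguments.
Unset Strict Implicit.
Unset Printing Implicit Defensive.

Import Order.TTheory GRing.Theory Num.Theory.
Import numFieldNormedType.Exports.

Local Open Scope classical_set_scope.
Local Open Scope ring_scope.

(* Write n for the number of vertices and b = 1 - alpha.  Since H n maximises
   lambda_0, every F-free G on n vertices has x^T A x <= Lam |x|^2 with
   Lam = sqrt (k n) + k; this bound, which is o(n), is the only consequence of
   F-freeness that is used before the last step.

   In A_alpha the diagonal dominates, and H n, which has k vertices of degree
   n - 1, satisfies
     lambda_alpha (H n) >= alpha (n - 1) + b (k - 1) + k b^2 / alpha - o(1).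
   Let L be the set of the vertices of G of degree at least theta n, for a
   theta < 1 with theta sqrt (k + 1) > sqrt k.  The bound on x^T A x forces
   #|L| <= k.  Eliminating the coordinates outside L shows that x^T A_alpha x is
   governed by the k x k form
     alpha sum_L deg(v) x_v^2 + b ((sum_L x)^2 - sum_L x^2)
       + (b^2 / alpha + o(1)) (sum_L x)^2,
   which falls short of the value above by a constant unless #|L| = k and all
   vertices of L have degree n - 1.  So a G with
   lambda_alpha G >= lambda_alpha (H n) has k dominating vertices; then G
   contains H n or is contained in it, and strict monotonicity of lambda_0 or of
   lambda_alpha, respectively, yields an isomorphism. *)

Lemma sqr_sum_le (R : realFieldType) (I : finType) (P : pred I) (y : I -> R) :
  (\sum_(i | P i) y i) ^+ 2 <= #|P|%:R * \sum_(i | P i) y i ^+ 2.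
Proof.
have [P0|P_gt0] := posnP #|P|.
  by rewrite !big_pred0 ?mulr0 ?expr0n //; apply: card0_eq.
set S := \sum_(i | P i) y i; set Y := \sum_(i | P i) y i ^+ 2.
(* These are the deviations from the mean, scaled by [#|P|] to avoid a division; their squares add
   up to [#|P|] times the defect in Cauchy-Schwarz. *)
have : 0 <= \sum_(i | P i) (#|P|%:R * y i - S) ^+ 2.
  by apply: sumr_ge0 => i _; apply: sqr_ge0.
have -> : \sum_(i | P i) (#|P|%:R * y i - S) ^+ 2 = #|P|%:R * (#|P|%:R * Y - S ^+ 2).
  transitivity (\sum_(i | P i) (#|P|%:R ^+ 2 * y i ^+ 2
                               - (2 * #|P|%:R * S) * y i + S ^+ 2)).
    by apply: eq_bigr => i _; ring.
  have SE : \sum_(i | P i) S ^+ 2 = #|P|%:R * S ^+ 2.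
    by rewrite mulr_natl -sumr_const; apply: eq_bigl.
  by rewrite big_split /= SE sumrB -!mulr_sumr -/S -/Y; ring.
by rewrite pmulr_rge0 ?ltr0n // subr_ge0.
Qed.

(** * Quadratic forms of real symmetric matrices and the Rayleigh principle *)

Section SymmetricMatrix.
Variables (R : realType) (n : nat).
Implicit Types (u v : 'rV[R]_n) (A B M : 'M[R]_n).

Definition dotmx u v : R := \sum_i u 0 i * v 0 i.

Lemma dotmxC u v : dotmx u v = dotmx v u.
Proof. by apply: eq_bigr => i _; rewrite mulrC. Qed.

Lemma dotmxDl u1 u2 v : dotmx (u1 + u2) v = dotmx u1 v + dotmx u2 v.
Proof. by rewrite -big_split; apply: eq_bigr => i _; rewrite mxE mulrDl. Qed.

Lemma dotmxZl a u v : dotmx (a *: u) v = a * dotmx u v.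
Proof. by rewrite mulr_sumr; apply: eq_bigr => i _; rewrite mxE mulrA. Qed.

Lemma dotmxDr u v1 v2 : dotmx u (v1 + v2) = dotmx u v1 + dotmx u v2.
Proof. by rewrite dotmxC dotmxDl !(dotmxC u). Qed.

Lemma dotmxZr a u v : dotmx u (a *: v) = a * dotmx u v.
Proof. by rewrite dotmxC dotmxZl dotmxC. Qed.

Lemma dotmx_ge0 u : 0 <= dotmx u u.
Proof. by apply: sumr_ge0 => i _; rewrite -expr2 sqr_ge0. Qed.

Lemma dotmx_eq0 u : (dotmx u u == 0) = (u == 0).
Proof.
apply/eqP/eqP => [h | ->]; last by apply: big1 => i _; rewrite mxE mul0r.
apply/rowP => i; rewrite mxE; apply/eqP; rewrite -sqrf_eq0 expr2; apply/eqP.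
by apply: (psumr_eq0P _ h) => // j _; rewrite -expr2 sqr_ge0.
Qed.

Lemma dotmx_mulr A u v : dotmx (u *m A) v = dotmx u (v *m A^T).
Proof.
rewrite /dotmx; under eq_bigr do rewrite mxE mulr_suml.
rewrite exchange_big; apply: eq_bigr => i _.
by rewrite mxE mulr_sumr; apply: eq_bigr => j _; rewrite mxE -mulrA [A _ _ * _]mulrC.
Qed.

Lemma dotmx_le u v : 2 * dotmx u v <= dotmx u u + dotmx v v.
Proof.
have := dotmx_ge0 (u - v); rewrite -scaleN1r !(dotmxDl, dotmxDr, dotmxZl, dotmxZr).
rewrite (dotmxC v u); lra.
Qed.

(** Cauchy-Schwarz in each coordinate of [u *m B]. The constant is crude; the added 1 keeps it
    positive when [B] vanishes or [n] is 0. *)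
Lemma mulmx_bounded B : exists2 K : R, 0 < K &
  forall u, dotmx (u *m B) (u *m B) <= K * dotmx u u.
Proof.
pose m := \sum_i \sum_j B i j ^+ 2.
have mB i j : B i j ^+ 2 <= m.
  rewrite /m (bigD1 i) //= (bigD1 j) //= -addrA lerDl.
  by rewrite addr_ge0 ?sumr_ge0 // => k _; rewrite ?sumr_ge0 ?sqr_ge0 // => l _; rewrite sqr_ge0.
have m0 : 0 <= m by apply: sumr_ge0 => i _; apply: sumr_ge0 => j _; apply: sqr_ge0.
have n0 : 0 <= n%:R :> R by [].
exists (n%:R * (n%:R * m) + 1) => [|u].
  by rewrite ltr_pwDr ?ltr01 // !mulr_ge0.
have uB j : (u *m B) 0 j * (u *m B) 0 j <= n%:R * m * dotmx u u.
  rewrite -expr2 mxE; apply: le_trans (sqr_sum_le _ _) _.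
  rewrite cardT size_enum_ord -mulrA ler_wpM2l // mulr_sumr ler_sum // => i _.
  by rewrite exprMn mulrC -expr2 ler_wpM2r ?sqr_ge0.
apply: le_trans (ler_sum _ (fun j _ => uB j)) _.
rewrite sumr_const card_ord -[X in X <= _]mulr_natl mulrDl mul1r -!mulrA lerDl.
exact: dotmx_ge0.
Qed.

Definition quadmx A u : R := dotmx (u *m A) u.

Definition psdmx A := forall u, 0 <= quadmx A u.

(* Expand [0 <= quadmx M (u - t *: (u *m M))] for a small [t]. *)
Lemma psdmx_bound M : M^T = M -> psdmx M ->
  exists2 K : R, 0 < K & forall u, dotmx (u *m M) (u *m M) <= K * quadmx M u.
Proof.
move=> Ms Mp; have [K K0 KM] := mulmx_bounded M.
have [K1 K10 K1M] : exists2 K1 : R, 0 < K1 & forall u, quadmx M u <= K1 * dotmx u u.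
  exists (K + 1) => [|u]; first by rewrite addr_gt0.
  have := dotmx_le (u *m M) u; have := KM u; have := dotmx_ge0 u.
  have := dotmx_ge0 (u *m M); rewrite /quadmx; lra.
exists K1 => // u; set w := u *m M.
(* With t = [K1^-1] and q = [quadmx M], the expansion is q(u) - 2 t |w|^2 + t^2 q(w), and q(w) <= K1
   |w|^2 bounds the last term by t |w|^2. *)
have := Mp (u - K1^-1 *: w); rewrite /quadmx mulmxBl -scalemxAl -scaleN1r -scaleNr.
rewrite -/w !(dotmxDl, dotmxDr, dotmxZl, dotmxZr).
have -> : dotmx (w *m M) u = dotmx w w by rewrite dotmx_mulr Ms.
have wM : dotmx (w *m M) w <= K1 * dotmx w w := K1M w.
have : K1^-1 ^+ 2 * dotmx (w *m M) w <= K1^-1 * dotmx w w.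
  by rewrite expr2 -mulrA ler_pM2l ?invr_gt0 // ler_pdivrMl.
move=> h1 h2.
have : 0 <= dotmx w u - K1^-1 * dotmx w w by lra.
by rewrite subr_ge0 ler_pdivrMl.
Qed.

Lemma quadmx_sub_scalar A a u : quadmx (a%:M - A) u = a * dotmx u u - quadmx A u.
Proof.
by rewrite /quadmx mulmxBr mul_mx_scalar -scaleN1r dotmxDl !dotmxZl mulN1r.
Qed.

Lemma trmx_scalar_sub A a : A^T = A -> (a%:M - A)^T = a%:M - A.
Proof. by move=> As; rewrite linearB /= tr_scalar_mx As. Qed.

(** Immediate from [psdmx_bound]; it turns a maximiser of the Rayleigh quotient into an
    eigenvector. *)
Lemma psdmx_ker M u : M^T = M -> psdmx M -> quadmx M u = 0 -> u *m M = 0.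
Proof.
move=> Ms Mp u0; have [K K0 /(_ u)] := psdmx_bound Ms Mp.
by rewrite u0 mulr0 => h; apply/eqP; rewrite -dotmx_eq0 eq_le h dotmx_ge0.
Qed.

(* If the supremum [a] of the Rayleigh quotient is not an eigenvalue, then
   [a%:M - A] is positive semidefinite and invertible, hence bounded below by
   a positive multiple of the identity, and [a] is not the least upper bound. *)
Lemma rayleigh A : (0 < n)%N -> A^T = A ->
  exists2 a : R, eigenvalue A a & forall u, quadmx A u <= a * dotmx u u.
Proof.
move=> n0 As; have [K K0 KA] := mulmx_bounded A.
pose S := [set b : R | exists2 u, dotmx u u = 1 & quadmx A u = b].
have S_nonempty : S !=set0.
  pose e : 'rV[R]_n := delta_mx 0 (Ordinal n0).
  exists (quadmx A e); exists e => //.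
  rewrite /dotmx (bigD1 (Ordinal n0)) //= big1 ?addr0 => [|i i0].
    by rewrite !mxE !eqxx mulr1.
  by rewrite !mxE (negbTE i0) mulr0.
have S_bound : ubound S (K + 1).
  move=> _ [u u1 <-]; have := dotmx_le (u *m A) u; have := KA u; have := dotmx_ge0 (u *m A).
  rewrite /quadmx u1; lra.
have S_sup : has_sup S by split=> //; exists (K + 1).
have le_sup u : quadmx A u <= sup S * dotmx u u.
  have [->|u0] := eqVneq u 0.
    by rewrite /quadmx mul0mx -(scale0r 0) !dotmxZl !mul0r mulr0.
  have d0 : 0 < dotmx u u by rewrite lt_neqAle eq_sym dotmx_eq0 u0 dotmx_ge0.
  rewrite -ler_pdivrMr //; apply: ub_le_sup; first by case: S_sup.
  pose t := Num.sqrt (dotmx u u).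
  have t2 : t ^+ 2 = dotmx u u by rewrite sqr_sqrtr // ltW.
  exists (t^-1 *: u).
    by rewrite dotmxZl dotmxZr mulrA -expr2 exprVn t2 mulVf // gt_eqF.
  by rewrite /quadmx -scalemxAl dotmxZl dotmxZr mulrA -expr2 exprVn t2 mulrC.
exists (sup S) => //; apply: contrapT => /negP nev.
pose M := (sup S)%:M - A.
have Ms : M^T = M by apply: trmx_scalar_sub.
have Mp : psdmx M by move=> u; rewrite quadmx_sub_scalar subr_ge0.
have Mu : M \in unitmx.
  rewrite -row_free_unit -kermx_eq0; move: nev; rewrite /eigenvalue /eigenspace negbK.
  move=> /eqP h; apply/eqP/row_matrixP => i; rewrite row0.
  have : (row i (kermx M) <= kermx (A - (sup S)%:M))%MS.
    apply/sub_kermxP; rewrite -opprB mulmxN -row_mul mulmx_ker row0 oppr0 //.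
  by rewrite h submx0 => /eqP.
have [K1 K10 K1M] := psdmx_bound Ms Mp.
have [K2 K20 K2M] := mulmx_bounded (invmx M).
(* A unit vector [u] is recovered from [u *m M], so 1 <= K2 |u M|^2 <= K2 K1 (sup S - quadmx A u):
   the quotients stay away from their supremum. *)
have : sup S <= sup S - (K2 * K1)^-1.
  apply: ge_sup => // _ [u u1 <-].
  have := K2M (u *m M); rewrite mulmxK // u1.
  have := K1M u; rewrite quadmx_sub_scalar u1 mulr1 => h1 h2.
  have : 1 <= K2 * K1 * (sup S - quadmx A u).
    by rewrite -mulrA; apply: le_trans h2 _; rewrite ler_pM2l.
  rewrite -ler_pdivrMl ?mulr_gt0 // mulr1; lra.
by rewrite lerBrDl gerDr leNgt invr_gt0 mulr_gt0.
Qed.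

End SymmetricMatrix.

(** * The quadratic form of [A_ al G] on functions of the vertices, and Perron vectors *)

Section GraphForm.
Variable R : realType.
Implicit Types (G : sgraph) (al : R).

Definition nrm2 G (x : G -> R) : R := \sum_v x v ^+ 2.

Definition adjform G (x y : G -> R) : R :=
  \sum_v x v * \sum_w (edge v w)%:R * y w.

(** The action of [A_ al G] on functions of the vertices, which replace the rows indexed by
    ['I_#|G|]; see [mulmx_A]. *)
Definition graph_op al G (x : G -> R) (v : G) : R :=
  al * (vertex_degree v)%:R * x v + (1 - al) * \sum_w (edge v w)%:R * x w.

Definition graph_form al G (x : G -> R) : R :=
  al * (\sum_v (vertex_degree v)%:R * x v ^+ 2) + (1 - al) * adjform x x.

Lemma graph_form_op al G (x : G -> R) :
  graph_form al x = \sum_v graph_op al x v * x v.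
Proof.
rewrite /graph_form /adjform !mulr_sumr -big_split; apply: eq_bigr => v _.
by rewrite /graph_op /=; ring.
Qed.

Lemma vertex_degreeE G (v : G) : (vertex_degree v)%:R = \sum_w (edge v w)%:R :> R.
Proof.
rewrite -natr_sum /vertex_degree -sum1dep_card big_mkcond.
by congr _%:R; apply: eq_bigr => w _; case: edge.
Qed.

Definition row_of G (x : G -> R) : 'rV[R]_#|G| := \row_i x (enum_val i).
Definition fun_of G (u : 'rV[R]_#|G|) : G -> R := fun v => u 0 (enum_rank v).

Lemma fun_ofK G (u : 'rV[R]_#|G|) : row_of (fun_of u) = u.
Proof. by apply/rowP => i; rewrite mxE /fun_of enum_valK. Qed.

Lemma sum_enum_val G (f : G -> R) : \sum_(i < #|G|) f (enum_val i) = \sum_v f v.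
Proof. by rewrite [RHS](reindex (enum_val : 'I_#|G| -> G)) //; exact/onW_bij/enum_val_bij. Qed.

Lemma A_sym al G : (A_ al G)^T = A_ al G.
Proof.
apply/matrixP => i j; rewrite !mxE edge_sym eq_sym.
by case: eqVneq => [->|_] //=; rewrite !mulr0n.
Qed.

Lemma mulmx_A al G (x : G -> R) : row_of x *m A_ al G = row_of (graph_op al x).
Proof.
apply/rowP => j; rewrite mulmxDr -!scalemxAr !mxE /graph_op; congr (_ + _ * _).
  rewrite (bigD1 j) //= big1 ?addr0 => [|i ij].
    by rewrite !mxE eqxx mulr1n; ring.
  by rewrite !mxE (negbTE ij) mulr0n mulr0.
rewrite -sum_enum_val; apply: eq_bigr => i _.
by rewrite !mxE edge_sym mulrC.
Qed.

Lemma nrm2_dotmx G (x : G -> R) : nrm2 x = dotmx (row_of x) (row_of x).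
Proof. by rewrite /nrm2 -sum_enum_val; apply: eq_bigr => i _; rewrite !mxE expr2. Qed.

Lemma graph_form_quadmx al G (x : G -> R) :
  graph_form al x = quadmx (A_ al G) (row_of x).
Proof.
rewrite graph_form_op -sum_enum_val /quadmx mulmx_A.
by apply: eq_bigr => i _; rewrite !mxE.
Qed.

Lemma nrm2_ge0 G (x : G -> R) : 0 <= nrm2 x.
Proof. by apply: sumr_ge0 => v _; apply: sqr_ge0. Qed.

Lemma nrm2_gt0 G (x : G -> R) v : x v != 0 -> 0 < nrm2 x.
Proof.
move=> xv; rewrite /nrm2 (bigD1 v) //= ltr_pwDl //; last by apply: sumr_ge0 => w _; apply: sqr_ge0.
by rewrite lt_neqAle sqr_ge0 eq_sym sqrf_eq0 xv.
Qed.

(** The eigenvalue [a] given by [rayleigh] bounds every other one, because an eigenvector for [b]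
    has Rayleigh quotient [b]. Hence the supremum defining [lambda_] is attained at [a]. *)
Lemma lambda_rayleigh al G : (0 < #|G|)%N ->
  eigenvalue (A_ al G) (lambda_ al G) /\
  forall x : G -> R, graph_form al x <= lambda_ al G * nrm2 x.
Proof.
move=> G0; have [a aev aq] := rayleigh G0 (A_sym al G).
suff -> : lambda_ al G = a.
  by split=> // x; rewrite graph_form_quadmx nrm2_dotmx.
have ub_a : ubound [set b | eigenvalue (A_ al G) b] a.
  move=> b /= /eigenvalueP[u uA u0].
  have := aq u; rewrite /quadmx uA dotmxZl ler_pM2r //.
  by rewrite lt_neqAle eq_sym dotmx_eq0 u0 dotmx_ge0.
apply/eqP; rewrite eq_le; apply/andP; split.
  by apply: ge_sup => //; exists a.
by apply: ub_le_sup => //; exists a.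
Qed.

Lemma graph_form_le al G (x : G -> R) : graph_form al x <= lambda_ al G * nrm2 x.
Proof.
(* Without vertices both sides vanish, whatever the value of the supremum. *)
have [G0|] := posnP #|G|; last by move=> /(lambda_rayleigh al)[_ ->].
have noG (v : G) : False by have := card0_eq G0 v; rewrite inE.
rewrite /graph_form /adjform /nrm2 !big1 ?mulr0 ?addr0 // => v; by case: (noG v).
Qed.

Lemma adjform_le_norm G (x : G -> R) :
  adjform x x <= adjform (fun v => `|x v|) (fun v => `|x v|).
Proof.
apply: ler_sum => v _; rewrite !mulr_sumr; apply: ler_sum => w _.
rewrite mulrCA [leRHS]mulrCA -normrM ler_wpM2l //; exact: ler_norm.
Qed.

Lemma nrm2_norm G (x : G -> R) : nrm2 (fun v => `|x v|) = nrm2 x.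
Proof. by apply: eq_bigr => v _; rewrite real_normK ?num_real. Qed.

Lemma graph_form_le_norm al G (x : G -> R) : al <= 1 ->
  graph_form al x <= graph_form al (fun v => `|x v|).
Proof.
move=> al1; rewrite /graph_form.
under [X in _ <= al * X + _]eq_bigr do rewrite real_normK ?num_real //.
by rewrite lerD2l ler_wpM2l ?subr_ge0 // adjform_le_norm.
Qed.

(* The absolute value of a top eigenvector also maximises the Rayleigh quotient. *)
Lemma perron_vector al G : al <= 1 -> (0 < #|G|)%N ->
  exists x : G -> R, [/\ forall v, 0 <= x v, 0 < nrm2 x &
    forall v, graph_op al x v = lambda_ al G * x v].
Proof.
move=> al1 G0; have [/eigenvalueP[u uA u0] _] := lambda_rayleigh al G0.
pose x v := `|fun_of u v|.
have x_gt0 : 0 < nrm2 x.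
  rewrite nrm2_norm nrm2_dotmx fun_ofK.
  by rewrite lt_neqAle eq_sym dotmx_eq0 u0 dotmx_ge0.
exists x; split=> // v; first exact: normr_ge0.
have qx : graph_form al x = lambda_ al G * nrm2 x.
  apply/eqP; rewrite eq_le graph_form_le /=; apply: le_trans (graph_form_le_norm _ al1).
  by rewrite nrm2_norm nrm2_dotmx graph_form_quadmx /quadmx fun_ofK uA dotmxZl.
(* [M] is positive semidefinite and its form vanishes at [x], so [x] lies in the kernel of [M]. *)
pose M := (lambda_ al G)%:M - A_ al G.
have Mp : psdmx M.
  move=> w; rewrite quadmx_sub_scalar subr_ge0 -(fun_ofK w) -graph_form_quadmx -nrm2_dotmx.
  exact: graph_form_le.
have : row_of x *m M = 0.
  apply: psdmx_ker => //; first by apply/trmx_scalar_sub/A_sym.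
  by rewrite quadmx_sub_scalar -graph_form_quadmx -nrm2_dotmx qx subrr.
rewrite /M mulmxBr mul_mx_scalar mulmx_A => /eqP; rewrite subr_eq0 => /eqP h.
have := congr1 (fun u : 'rV_#|G| => u 0 (enum_rank v)) h.
by rewrite !mxE enum_rankK.
Qed.

Lemma perron_form al G (x : G -> R) l :
  (forall v, graph_op al x v = l * x v) -> graph_form al x = l * nrm2 x.
Proof.
move=> h; rewrite graph_form_op /nrm2 mulr_sumr.
by apply: eq_bigr => v _; rewrite h expr2 mulrA.
Qed.

Definition dominating G (v : G) := forall w, w != v -> edge v w.

(** Zeros spread along edges: where [x] vanishes, the eigenvalue equation is a vanishing sum of
    nonnegative terms over the neighbours. From any zero one reaches [c], and from [c] all vertices,
    contradicting [x] being nonzero. *)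
Lemma perron_vector_gt0 al G (x : G -> R) l (c : G) : al < 1 -> dominating c ->
  (forall v, 0 <= x v) -> 0 < nrm2 x ->
  (forall v, graph_op al x v = l * x v) -> forall v, 0 < x v.
Proof.
move=> al1 cdom x0 xn xe.
have nb v w : x v = 0 -> edge v w -> x w = 0.
  move=> xv vw; have := xe v; rewrite /graph_op xv !mulr0 add0r => /eqP.
  rewrite mulf_eq0 subr_eq0 gt_eqF //= => /eqP.
  move/psumr_eq0P => /(_ _ w isT); rewrite vw mul1r; apply=> z _.
  by rewrite mulr_ge0.
have xc : x c != 0.
  apply/eqP => xc; move: xn; rewrite /nrm2 big1 ?ltxx // => v _.
  have [->|vc] := eqVneq v c; first by rewrite xc expr0n.
  by rewrite (nb c) ?expr0n //; apply: cdom.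
move=> v; rewrite lt_neqAle x0 andbT eq_sym; apply/eqP => xv.
case/eqP: xc; have [<-//|vc] := eqVneq v c.
by apply: (nb v) => //; rewrite edge_sym; apply: cdom.
Qed.

End GraphForm.

(** * Colour-preserving bijections and graph isomorphisms *)

Lemma colour_bij (T U C : finType) (c : T -> C) (d : U -> C) :
  (forall i, #|[set x | c x == i]%SET| = #|[set y | d y == i]%SET|) ->
  exists2 f : T -> U, bijective f & forall x, d (f x) = c x.
Proof.
move=> cd.
have card_fibres (V : finType) (e : V -> C) : (\sum_i #|[set x | e x == i]%SET|)%N = #|V|.
  rewrite -sum1_card (partition_big e predT) //=; apply: eq_bigr => i _.
  by rewrite -sum1dep_card.
have TU : #|T| = #|U|.
  by rewrite -(card_fibres _ c) -(card_fibres _ d); apply: eq_bigr => i _; apply: cd.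
(* [u0] serves as the default of [nth]; if [U] is empty, so is [T]. *)
have [u0 _|U0] := pickP (predT : pred U); last first.
  have noT (x : T) : U by have := eq_card0 U0; rewrite -TU => /card0_eq/(_ x).
  exists noT; last by move=> x; have := U0 (noT x).
  by apply: inj_card_bij; rewrite ?TU // => x; have := U0 (noT x).
pose cl x := enum [set z | c z == c x]%SET.
(* The i-th element of a colour class of [T] goes to the i-th element of the class of the same
   colour in [U]. *)
pose f x := nth u0 (enum [set y | d y == c x]%SET) (index x (cl x)).
have idx x : (index x (cl x) < size (enum [set y | d y == c x]%SET))%N.
  by rewrite -cardE -cd cardE index_mem mem_enum inE.
have df x : d (f x) = c x.
  by have := mem_nth u0 (idx x); rewrite mem_enum inE => /eqP.
exists f => //; apply: inj_card_bij; last by rewrite TU.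
move=> x y fxy; have cxy : c x = c y by rewrite -!df fxy.
move: fxy; rewrite /f -cxy => /eqP; rewrite nth_uniq ?enum_uniq //; last by rewrite cxy idx.
rewrite /cl -cxy => /eqP ixy; have x0 := x.
have xin : x \in cl x by rewrite mem_enum inE.
have yin : y \in cl x by rewrite mem_enum inE cxy.
by rewrite -(nth_index x xin) -(nth_index x yin) ixy.
Qed.

Lemma isomorphic_sym (G H : sgraph) : isomorphic G H -> isomorphic H G.
Proof.
case=> f [g fK gK] fe; exists g; first by exists f.
by move=> x y; rewrite -fe !gK.
Qed.

Lemma isomorphic_card (G H : sgraph) : isomorphic G H -> #|G| = #|H|.
Proof. by case=> f /bij_eq_card. Qed.

Lemma isomorphic_family_free (F : graph_family) (G H : sgraph) :
  isomorphic G H -> family_free F H -> family_free F G.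
Proof.
move=> [f fb fe] Hf F0 FF0 [g gi ge]; apply: (Hf F0 FF0); exists (f \o g).
  exact: inj_comp (bij_inj fb) gi.
by move=> x y xy /=; rewrite fe ge.
Qed.

(** * Monotonicity of [lambda_] under bijective homomorphisms *)

Section Monotonicity.
Variables (R : realType) (al : R).
Implicit Types G : sgraph.

Lemma nrm2_bij G G' (f : G -> G') (x : G' -> R) :
  bijective f -> nrm2 (x \o f) = nrm2 x.
Proof. by move=> fb; rewrite [RHS](reindex f) //; apply: onW_bij. Qed.

Lemma vertex_degree_hom G G' (f : G -> G') (v : G) : injective f ->
  (forall v w, edge v w -> edge (f v) (f w)) ->
  (vertex_degree v <= vertex_degree (f v))%N.
Proof.
move=> fi fe; rewrite /vertex_degree -(card_imset _ fi); apply: subset_leq_card.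
apply/fintype.subsetP => u /finset.imsetP[w]; rewrite !inE => vw ->; exact: fe.
Qed.

Lemma adjform_bij G G' (f : G -> G') (x y : G' -> R) : bijective f ->
  adjform x y = \sum_v \sum_w (edge (f v) (f w))%:R * (x (f v) * y (f w)).
Proof.
move=> fb; rewrite /adjform (reindex f) /=; last exact: onW_bij.
apply: eq_bigr => v _; rewrite mulr_sumr (reindex f) /=; last exact: onW_bij.
by apply: eq_bigr => w _; rewrite mulrCA.
Qed.

Lemma graph_form_hom G G' (f : G -> G') (x : G' -> R) : 0 <= al <= 1 ->
  bijective f -> (forall v w, edge v w -> edge (f v) (f w)) -> (forall v, 0 <= x v) ->
  graph_form al (x \o f) <= graph_form al x.
Proof.
move=> /andP[al0 al1] fb fe x0; apply: lerD; apply: ler_wpM2l; rewrite ?subr_ge0 //.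
  rewrite [leRHS](reindex f) /=; last exact: onW_bij.
  apply: ler_sum => v _; apply: ler_wpM2r; first exact: sqr_ge0.
  by rewrite ler_nat vertex_degree_hom //; apply: bij_inj.
rewrite (adjform_bij _ _ fb) /adjform; apply: ler_sum => v _.
rewrite mulr_sumr; apply: ler_sum => w _; rewrite mulrCA /=.
apply: ler_wpM2r; first exact: mulr_ge0.
by case: (boolP (edge v w)) => [/fe->|].
Qed.

(** The degree part is compared weakly only. The strict gain is the additional edge's term in
    [adjform], positive since [x] is, with weight [1 - al] positive. *)
Lemma graph_form_hom_lt G G' (f : G -> G') (x : G' -> R) v w : 0 <= al < 1 ->
  bijective f -> (forall v w, edge v w -> edge (f v) (f w)) -> (forall v, 0 < x v) ->
  edge (f v) (f w) -> ~~ edge v w ->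
  graph_form al (x \o f) < graph_form al x.
Proof.
move=> /andP[al0 al1] fb fe x0 fvw nvw; apply: ler_ltD.
  apply: ler_wpM2l => //; rewrite [leRHS](reindex f) /=; last exact: onW_bij.
  apply: ler_sum => u _; apply: ler_wpM2r; first exact: sqr_ge0.
  by rewrite ler_nat vertex_degree_hom //; apply: bij_inj.
rewrite ltr_pM2l ?subr_gt0 // (adjform_bij _ _ fb) /adjform.
have le_edge u t : x (f u) * ((edge u t)%:R * x (f t)) <=
    (edge (f u) (f t))%:R * (x (f u) * x (f t)).
  rewrite mulrCA; apply: ler_wpM2r; first by rewrite mulr_ge0 // ltW.
  by case: (boolP (edge u t)) => [/fe->|].
rewrite (bigD1 v) //= [ltRHS](bigD1 v) //=; apply: ltr_leD; last first.
  apply: ler_sum => u _; rewrite mulr_sumr; apply: ler_sum => t _; exact: le_edge.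
rewrite mulr_sumr (bigD1 w) //= [ltRHS](bigD1 w) //=; apply: ltr_leD; last first.
  by apply: ler_sum => t _; apply: le_edge.
by rewrite fvw (negbTE nvw) mul0r mulr0 mul1r mulr_gt0.
Qed.

(** The Perron vector of [G], transported along [f], is a nonnegative test vector for [G'], and
    additional edges can only increase its form. *)
Lemma lambda_le_hom G G' (f : G -> G') : 0 <= al <= 1 -> (0 < #|G|)%N ->
  bijective f -> (forall v w, edge v w -> edge (f v) (f w)) ->
  lambda_ al G <= lambda_ al G'.
Proof.
move=> al01 G0 fb fe; have /andP[_ al1] := al01; have [g fK gK] := fb.
have [x [x0 xn xe]] := perron_vector al1 G0.
have xgf : x \o g \o f = x by apply/funext => v /=; rewrite fK.
have := graph_form_hom al01 fb fe (fun v => x0 (g v)).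
rewrite xgf (perron_form xe) => h.
have := le_trans h (graph_form_le al (x \o g)).
by rewrite -(nrm2_bij _ fb) xgf ler_pM2r.
Qed.

Lemma lambda_iso G G' : 0 <= al <= 1 -> (0 < #|G|)%N ->
  isomorphic G G' -> lambda_ al G = lambda_ al G'.
Proof.
move=> al01 G0 iGG'; apply/eqP; rewrite eq_le; apply/andP; split.
  by case: iGG' => f fb fe; apply: (lambda_le_hom al01 G0 fb) => v w; rewrite fe.
have G'0 : (0 < #|G'|)%N by rewrite -(isomorphic_card iGG').
case: (isomorphic_sym iGG') => f fb fe.
by apply: (lambda_le_hom al01 G'0 fb) => v w; rewrite fe.
Qed.

(** A non-edge sent to an edge would strictly increase [lambda_]. The dominating vertex [c] makes
    the Perron vector positive, as strictness requires. *)
Lemma hom_isomorphic G G' (f : G -> G') (c : G) : 0 <= al < 1 ->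
  dominating c -> bijective f -> (forall v w, edge v w -> edge (f v) (f w)) ->
  lambda_ al G' <= lambda_ al G -> isomorphic G G'.
Proof.
move=> al01 cdom fb fe lGG'; exists f => // v w.
have /andP[al0 al1] := al01; have [g fK gK] := fb.
have G0 : (0 < #|G|)%N by apply/card_gt0P; exists c.
have [x [x0 xn xe]] := perron_vector (ltW al1) G0.
have {}x0 := perron_vector_gt0 al1 cdom x0 xn xe.
apply/idP/idP => [fvw|]; last exact: fe.
apply: contraT => nvw.
have xgf : x \o g \o f = x by apply/funext => u /=; rewrite fK.
have := graph_form_hom_lt al01 fb fe (fun v => x0 (g v)) fvw nvw.
rewrite xgf (perron_form xe) => h.
have := lt_le_trans h (graph_form_le al (x \o g)).
by rewrite -(nrm2_bij _ fb) xgf ltr_pM2r // ltNge lGG'.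
Qed.

End Monotonicity.

(** * Splitting the adjacency form along a vertex set [L] *)

Section Restriction.
Variable R : realType.
Implicit Types G : sgraph.

Definition restr G (L : {set G}) (x : G -> R) (v : G) : R :=
  if v \in L then x v else 0.

Lemma restr_ge0 G (L : {set G}) (x : G -> R) :
  (forall v, 0 <= x v) -> forall v, 0 <= restr L x v.
Proof. by move=> x0 v; rewrite /restr; case: ifP. Qed.

Lemma sum_restr G (L : {set G}) (x : G -> R) : \sum_v restr L x v = \sum_(v in L) x v.
Proof. by rewrite -big_mkcond. Qed.

Lemma nrm2_restr G (L : {set G}) (x : G -> R) : nrm2 (restr L x) = \sum_(v in L) x v ^+ 2.
Proof.
rewrite [RHS]big_mkcond; apply: eq_bigr => v _.
by rewrite /restr; case: ifP => // _; rewrite expr0n.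
Qed.

Lemma sum_split_set G (L : {set G}) (f : G -> R) :
  \sum_v f v = \sum_(v in L) f v + \sum_(v in ~: L) f v.
Proof.
rewrite (bigID (mem L)) /=; congr (_ + _).
by apply: eq_bigl => v; rewrite inE.
Qed.

Lemma adjformC G (x y : G -> R) : adjform x y = adjform y x.
Proof.
rewrite /adjform; under eq_bigr do rewrite mulr_sumr.
rewrite exchange_big; apply: eq_bigr => v _; rewrite mulr_sumr.
by apply: eq_bigr => w _; rewrite edge_sym; ring.
Qed.

Lemma adjformDl G (x1 x2 y : G -> R) :
  adjform (fun v => x1 v + x2 v) y = adjform x1 y + adjform x2 y.
Proof. by rewrite -big_split; apply: eq_bigr => v _; rewrite mulrDl. Qed.

Lemma adjform_split G (L : {set G}) (x : G -> R) :
  adjform x x = adjform (restr L x) (restr L x)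
    + 2 * adjform (restr L x) (restr (~: L) x) + adjform (restr (~: L) x) (restr (~: L) x).
Proof.
have xE : x = fun v => restr L x v + restr (~: L) x v.
  by apply/funext => v; rewrite /restr inE; case: ifP; rewrite ?addr0 ?add0r.
rewrite {1 2}xE adjformDl 2!(adjformC _ (fun v => _ + _)) !adjformDl.
rewrite (adjformC (restr (~: L) x) (restr L x)); ring.
Qed.

Lemma adjform_ge0 G (x y : G -> R) :
  (forall v, 0 <= x v) -> (forall v, 0 <= y v) -> 0 <= adjform x y.
Proof.
move=> x0 y0; apply: sumr_ge0 => v _; apply: mulr_ge0 => //.
by apply: sumr_ge0 => w _; apply: mulr_ge0.
Qed.

Lemma adjform_le_prod G (x y : G -> R) :
  (forall v, 0 <= x v) -> (forall v, 0 <= y v) ->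
  adjform x y <= (\sum_v x v) * (\sum_v y v).
Proof.
move=> x0 y0; rewrite mulr_suml; apply: ler_sum => v _; apply: ler_wpM2l => //.
by apply: ler_sum => w _; case: edge; rewrite ?mul1r ?mul0r.
Qed.

(** The right-hand side is the adjacency form of the complete graph on the vertices of [G]. *)
Lemma adjform_le_clique G (x : G -> R) :
  (forall v, 0 <= x v) -> adjform x x <= (\sum_v x v) ^+ 2 - nrm2 x.
Proof.
move=> x0; rewrite expr2 mulr_suml -sumrB; apply: ler_sum => v _.
rewrite expr2 -mulrBr; apply: ler_wpM2l => //.
rewrite (bigD1 v) //= edge_irr mul0r add0r [leRHS](_ : _ = \sum_(w | w != v) x w).
  by apply: ler_sum => w _; case: edge; rewrite ?mul1r ?mul0r.
by rewrite (bigD1 v) //=; ring.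
Qed.

Lemma vertex_degree_lt G (v : G) : (vertex_degree v < #|G|)%N.
Proof.
rewrite /vertex_degree -cardsT; apply: proper_card; rewrite finset.properEneq finset.subsetT andbT.
by apply/eqP => h; have := finset.in_setT v; rewrite -h inE edge_irr.
Qed.

(** Evaluate the bound at the constant vector 1, whose adjacency form is the sum of the degrees. *)
Lemma sum_degree_le G (Lam : R) :
  (forall x : G -> R, (forall v, 0 <= x v) -> adjform x x <= Lam * nrm2 x) ->
  \sum_(v : G) (vertex_degree v)%:R <= Lam * #|G|%:R.
Proof.
move=> /(_ (fun=> 1) (fun=> ler01)); rewrite /adjform /nrm2 expr1n sumr_const.
by under eq_bigr do [under eq_bigr do rewrite mulr1; rewrite -vertex_degreeE mul1r].
Qed.

(** The edges outside [L] form a matching. Bounding each product by half the sum of the two squares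
    charges every square at most once. *)
Lemma adjform_le_matching G (L : {set G}) (x : G -> R) :
  (forall v, v \notin L -> #|[set w | edge v w & w \notin L]%SET| <= 1)%N ->
  (forall v, 0 <= x v) ->
  adjform (restr (~: L) x) (restr (~: L) x) <= nrm2 (restr (~: L) x).
Proof.
move=> hL x0; set z := restr _ x.
have zL v : v \in L -> z v = 0 by move=> vL; rewrite /z /restr inE vL.
pose e v w : R := (edge v w && (v \notin L) && (w \notin L))%:R.
have eC v w : e v w = e w v by rewrite /e edge_sym -!andbA [(v \notin L) && _]andbC.
have zE v : \sum_w e v w * z v ^+ 2 <= z v ^+ 2.
  rewrite -mulr_suml; have [vL|vL] := boolP (v \in L); first by rewrite zL // expr0n mulr0.
  rewrite -[leRHS]mul1r; apply: ler_wpM2r; first exact: sqr_ge0.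
  rewrite /e -natr_sum (_ : 1 = 1%:R) // ler_nat; apply: leq_trans (hL v vL).
  rewrite -sum1dep_card [leqRHS]big_mkcond; apply: leq_sum => w _.
  by rewrite vL andbT; case: (_ && _).
apply: (@le_trans _ _ (\sum_v \sum_w (e v w * z v ^+ 2 + e w v * z w ^+ 2) / 2)).
  apply: ler_sum => v _; rewrite mulr_sumr; apply: ler_sum => w _.
  rewrite (eC w v) -mulrDr /e.
  have [vL|vL] := boolP (v \in L); first by rewrite (zL v) // !mul0r andbF !mul0r.
  have [wL|wL] := boolP (w \in L); first by rewrite (zL w) // !mulr0 andbF !mul0r.
  rewrite !andbT mulrCA -mulrA; apply: ler_wpM2l => //.
  by have := sqr_ge0 (z v - z w); rewrite sqrrB; lra.
under eq_bigr do rewrite -mulr_suml big_split.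
rewrite -mulr_suml big_split /= [X in _ + X]exchange_big /=.
have h : \sum_v \sum_w e v w * z v ^+ 2 <= nrm2 z by apply: ler_sum => v _; apply: zE.
by lra.
Qed.

(** Write S, Y and W, Z for the sums of entries and of squares on [L] and off [L]. The cross term is
    2 S W <= 2 sqrt(k Y n Z) <= sqrt(k n) (Y + Z); the summand k absorbs S^2 - Y <= (k - 1) Y inside
    [L] and the matching bound Z outside. *)
Lemma adjform_join_le G (L : {set G}) (x : G -> R) k : (0 < k)%N -> #|L| = k ->
  (forall v, v \notin L -> #|[set w | edge v w & w \notin L]%SET| <= 1)%N ->
  (forall v, 0 <= x v) ->
  adjform x x <= (Num.sqrt (k%:R * #|G|%:R) + k%:R) * nrm2 x.
Proof.
move=> k0 Lk hL x0; rewrite (adjform_split L).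
set y := restr L x; set z := restr (~: L) x.
have y0 v : 0 <= y v by apply: restr_ge0.
have z0 v : 0 <= z v by apply: restr_ge0.
have yy := adjform_le_clique y0; have yz := adjform_le_prod y0 z0.
have zz := adjform_le_matching hL x0; rewrite -/z in zz.
have xx : nrm2 x = nrm2 y + nrm2 z by rewrite !nrm2_restr -sum_split_set.
have S2 : (\sum_v y v) ^+ 2 <= k%:R * nrm2 y.
  by rewrite sum_restr nrm2_restr -Lk; apply: sqr_sum_le.
have W2 : (\sum_v z v) ^+ 2 <= #|G|%:R * nrm2 z.
  by have := sqr_sum_le predT z; rewrite cardT -cardE.
have S0 : 0 <= \sum_v y v by apply: sumr_ge0.
have W0 : 0 <= \sum_v z v by apply: sumr_ge0.
move: S2 W2 yy yz zz S0 W0; rewrite xx.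
have := nrm2_ge0 y; have := nrm2_ge0 z.
move: (\sum_v y v) (\sum_v z v) (nrm2 y) (nrm2 z) => S W Y Z Z0 Y0 S2 W2 yy yz zz S0 W0.
set r := Num.sqrt _.
have r0 : 0 <= r by apply: sqrtr_ge0.
have r2 : r ^+ 2 = k%:R * #|G|%:R by rewrite sqr_sqrtr // mulr_ge0.
have SW : 2 * (S * W) <= r * (Y + Z).
  rewrite -(@ler_pXn2r _ 2) ?nnegrE ?mulr_ge0 ?addr_ge0 //.
  have -> : (2 * (S * W)) ^+ 2 = 4 * (S ^+ 2 * W ^+ 2) by ring.
  have h : S ^+ 2 * W ^+ 2 <= (k%:R * Y) * (#|G|%:R * Z) by apply: ler_pM; rewrite ?sqr_ge0.
  have -> : (r * (Y + Z)) ^+ 2 = k%:R * #|G|%:R * (Y + Z) ^+ 2 by rewrite exprMn r2.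
  have h2 : k%:R * #|G|%:R * (4 * (Y * Z)) <= k%:R * #|G|%:R * (Y + Z) ^+ 2.
    apply: ler_wpM2l; first exact: mulr_ge0.
    by have := sqr_ge0 (Y - Z); rewrite sqrrB sqrrD; lra.
  by apply: le_trans h2; lra.
have k1 : 1 <= k%:R :> R by rewrite ler1n.
have kZ : Z <= k%:R * Z by rewrite ler_peMl.
rewrite mulrDl; lra.
Qed.

Lemma sum_if_set G (L : {set G}) (s t : R) :
  \sum_v (if v \in L then s else t) = #|L|%:R * s + (#|G|%:R - #|L|%:R) * t.
Proof.
rewrite (sum_split_set L); congr (_ + _).
  by rewrite mulr_natl -sumr_const; apply: eq_bigr => v ->.
rewrite -(cardsC L) natrD addrAC subrr add0r mulr_natl -sumr_const.
by apply: eq_bigr => v; rewrite inE => /negbTE ->.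
Qed.

(** Only the degrees of the vertices of [L] and the edges meeting [L] are counted; all other
    contributions are nonnegative and dropped. *)
Lemma graph_form_join_ge G (L : {set G}) (al s : R) : 0 <= al <= 1 -> 0 <= s ->
  (forall v, v \in L -> dominating v) ->
  al * (#|L|%:R * (#|G|%:R - 1)) +
  (1 - al) * (#|L|%:R * (#|L|%:R - 1) + 2 * #|L|%:R * (#|G|%:R - #|L|%:R) * s)
  <= graph_form al (fun v => if v \in L then 1 else s).
Proof.
move=> /andP[al0 al1] s0 Ldom; set x := fun v => _.
have x0 v : 0 <= x v by rewrite /x; case: ifP.
have degL v : v \in L -> (vertex_degree v)%:R = #|G|%:R - 1 :> R.
  move=> vL; rewrite vertex_degreeE (bigD1 v) //= edge_irr add0r.
  transitivity (\sum_(w | w != v) (1 : R)).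
    by apply: eq_bigr => w /(Ldom v vL) ->.
  have G0 : (0 < #|G|)%N by apply/card_gt0P; exists v.
  by rewrite (sumr_const (predC1 v)) cardC1 -subn1 natrB.
apply: lerD; apply: ler_wpM2l; rewrite ?subr_ge0 //.
  rewrite (sum_split_set L) -[leLHS]addr0; apply: lerD.
    rewrite mulr_natl -sumr_const; apply: ler_sum => v vL.
    by rewrite /x vL degL // expr1n mulr1.
  by apply: sumr_ge0 => v _; rewrite mulr_ge0 ?sqr_ge0.
rewrite [leLHS](_ : _ = \sum_v (if v \in L then
    #|L|%:R - 1 + (#|G|%:R - #|L|%:R) * s else #|L|%:R * s)); last first.
  by rewrite sum_if_set; ring.
apply: ler_sum => v _; rewrite {1}/x; case: ifP => vL.
  rewrite mul1r (bigD1 v) //= edge_irr mul0r add0r.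
  have := sum_if_set L 1 s; rewrite mulr1 (bigD1 v) //= vL => h.
  rewrite [leRHS](_ : _ = \sum_(w | w != v) x w); last first.
    by apply: eq_bigr => w wv; rewrite (Ldom v) ?mul1r.
  rewrite /x; lra.
rewrite mulrC; apply: ler_wpM2l => //; rewrite (sum_split_set L) -[leLHS]addr0; apply: lerD.
  rewrite -[#|L|%:R]sumr_const; apply: ler_sum => w wL.
  rewrite /x wL mulr1 edge_sym (Ldom w) //.
  by apply/eqP => vw; rewrite vw wL in vL.
by apply: sumr_ge0 => w _; rewrite mulr_ge0.
Qed.

End Restriction.

(** * Bounds in terms of the set of vertices of high degree *)

Section HighDegree.
Variable R : realType.
Implicit Types G : sgraph.

(* Test vector: [sqrt #|G|] on [L], [sqrt (k + 1)] elsewhere. *)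
Lemma few_high_degrees G (L : {set G}) (k : nat) (h Lam : R) :
  (forall x : G -> R, (forall v, 0 <= x v) -> adjform x x <= Lam * nrm2 x) ->
  (0 < #|G|)%N -> 0 <= h - k%:R ->
  (forall v, v \in L -> h <= (vertex_degree v)%:R) -> #|L| = k.+1 ->
  Num.sqrt (k.+1%:R * #|G|%:R) * (h - k%:R) <= Lam * #|G|%:R.
Proof.
move=> GLam G0 hk degL Lk.
pose p := Num.sqrt (#|G|%:R : R); pose q := Num.sqrt (k.+1%:R : R).
have p0 : 0 < p by rewrite sqrtr_gt0 ltr0n.
have q0 : 0 < q by rewrite sqrtr_gt0 ltr0n.
have p2 : p ^+ 2 = #|G|%:R by rewrite sqr_sqrtr.
have q2 : q ^+ 2 = k.+1%:R by rewrite sqr_sqrtr.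
pose x (v : G) := if v \in L then p else q.
have x0 v : 0 <= x v by rewrite /x; case: ifP => _; apply: ltW.
have xn : nrm2 x <= 2 * (k.+1%:R * #|G|%:R).
  rewrite /nrm2 (eq_bigr (fun v => if v \in L then #|G|%:R else k.+1%:R)) => [|v _].
    by rewrite sum_if_set Lk mulrBl; have := sqr_ge0 (k.+1%:R : R); lra.
  by rewrite /x; case: ifP; rewrite ?p2 ?q2.
(* A vertex of [L] has at most [k] neighbours in [L], hence at least [h - k] outside. *)
have cross : k.+1%:R * (h - k%:R) * (p * q) <= adjform (restr L x) (restr (~: L) x).
  rewrite /adjform (sum_split_set L) [X in _ <= _ + X]big1 ?addr0 => [|v]; last first.
    by rewrite inE /restr => /negbTE ->; rewrite mul0r.
  rewrite [leLHS](_ : _ = \sum_(v in L) p * ((h - k%:R) * q)); last first.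
    by rewrite sumr_const Lk -[RHS]mulr_natl; ring.
  apply: ler_sum => v vL; rewrite {1}/restr vL {1}/x vL; apply: ler_wpM2l; first exact: ltW.
  rewrite [leRHS](_ : _ = (\sum_(w in ~: L) (edge v w)%:R) * q); last first.
    rewrite (sum_split_set L) big1 ?add0r => [|w wL].
      rewrite mulr_suml; apply: eq_bigr => w; rewrite /restr => wL; rewrite wL.
      by move: wL; rewrite inE /x => /negbTE ->.
    by rewrite /restr inE wL mulr0.
  apply: ler_wpM2r; first exact: ltW.
  have := degL v vL; rewrite vertex_degreeE (sum_split_set L).
  have : \sum_(w in L) (edge v w)%:R <= k%:R :> R.
    rewrite (bigD1 v) //= edge_irr add0r -natr_sum ler_nat.
    have -> : k = #|L :\ v| by have := cardsD1 v L; rewrite vL Lk => -[].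
    rewrite -sum1_card [leqRHS](eq_bigl (fun w => (w \in L) && (w != v))) => [|w].
      by apply: leq_sum => w _; case: edge.
    by rewrite !inE andbC.
  lra.
have := GLam x x0; rewrite (adjform_split L).
have := adjform_ge0 (restr_ge0 L x0) (restr_ge0 L x0).
have := adjform_ge0 (restr_ge0 (~: L) x0) (restr_ge0 (~: L) x0).
move=> a1 a2 a3.
have Lam0 : 0 <= Lam.
  have nx : 0 < nrm2 x.
    have /card_gt0P[v _] := G0; apply: (@nrm2_gt0 _ _ _ v).
    by rewrite /x; case: ifP; rewrite gt_eqF.
  rewrite -(pmulr_lge0 _ nx); have := mulr_ge0 (mulr_ge0 (ler0n R k.+1) hk) (mulr_ge0 (ltW p0) (ltW q0)).
  lra.
have := ler_wpM2l Lam0 xn => a4.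
have -> : Num.sqrt (k.+1%:R * #|G|%:R) = p * q by rewrite sqrtrM // mulrC.
have k0 : 0 < k.+1%:R :> R by rewrite ltr0n.
rewrite -(ler_pM2l k0); lra.
Qed.

(* Completing the square in each coordinate outside [L]; the vertex [v] costs
   [1 / (mu' - al d)], which is at most
   [1 / mu' + al d / (mu' (mu' - al h))], where [d] is the degree of [v]. *)
Lemma graph_form_upper G (L : {set G}) (x : G -> R) (al Lam h mu C : R) :
  0 < al < 1 -> (forall v, 0 <= x v) ->
  (forall y : G -> R, (forall v, 0 <= y v) -> adjform y y <= Lam * nrm2 y) ->
  (forall v, v \notin L -> (vertex_degree v)%:R <= h) ->
  let mu' := mu - (1 - al) * Lam in 0 < mu' -> 0 < mu' - al * h ->
  (1 - al) ^+ 2 * (#|G|%:R / mu' + al * (Lam * #|G|%:R) / (mu' * (mu' - al * h))) <= C ->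
  graph_form al x <= al * (\sum_(v in L) (vertex_degree v)%:R * x v ^+ 2)
    + (1 - al) * ((\sum_(v in L) x v) ^+ 2 - \sum_(v in L) x v ^+ 2)
    + C * (\sum_(v in L) x v) ^+ 2
    + mu * \sum_(v in ~: L) x v ^+ 2.
Proof.
move=> /andP[al0 al1] x0 GLam degL mu' mu'0 mu'h hC; set S := \sum_(v in L) x v; pose b := 1 - al.
have b0 : 0 < b by rewrite subr_gt0.
rewrite /graph_form (adjform_split L) -/b.
set y := restr L x; set z := restr (~: L) x.
have y0 v : 0 <= y v by apply: restr_ge0.
have z0 v : 0 <= z v by apply: restr_ge0.
have yy := adjform_le_clique y0; have yz := adjform_le_prod y0 z0.
have zz := GLam z z0.
rewrite !sum_restr ?nrm2_restr -/S in yy yz zz.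
rewrite (sum_split_set L).
set D := \sum_(v in L) _; set Y := \sum_(v in L) _ in yy *.
set D' := \sum_(v in ~: L) (vertex_degree v)%:R * _.
set Z := \sum_(v in ~: L) _ in zz *; set W := \sum_(v in ~: L) _ in yz *.
have S0 : 0 <= S by apply: sumr_ge0.
pose c (v : G) := 1 / mu' + al * (vertex_degree v)%:R / (mu' * (mu' - al * h)).
have pv v : v \notin L -> 0 < mu' - al * (vertex_degree v)%:R.
  by move=> /degL /(ler_wpM2l (ltW al0)); lra.
(* After clearing denominators the difference of the two sides is al d (al h - al d), where d is the
   degree of [v]. *)
have cv v : v \notin L -> 1 <= (mu' - al * (vertex_degree v)%:R) * c v.
  move=> vL; have /(ler_wpM2l (ltW al0)) dh := degL v vL.
  have cE : mu' * (mu' - al * h) * c v = mu' - al * h + al * (vertex_degree v)%:R.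
    by rewrite /c; field; rewrite !gt_eqF.
  rewrite -(ler_pM2l (mulr_gt0 mu'0 mu'h)) mulr1 mulrCA cE.
  have d0 : 0 <= al * (vertex_degree v)%:R by rewrite mulr_ge0 // ltW.
  have dh' : 0 <= al * h - al * (vertex_degree v)%:R by rewrite subr_ge0.
  have := mulr_ge0 d0 dh'; lra.
(* Coordinatewise, after multiplication by p = mu' - al d, this is (p x_v - b S)^2 >= 0 together
   with p c_v >= 1. *)
have step : 2 * b * (S * W) <= mu' * Z - al * D' + b ^+ 2 * S ^+ 2 * \sum_(v in ~: L) c v.
  rewrite /W /Z /D' !mulr_sumr -sumrB -big_split /=.
  apply: ler_sum => v; rewrite inE => vL.
  have -> : mu' * x v ^+ 2 - al * ((vertex_degree v)%:R * x v ^+ 2) =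
    (mu' - al * (vertex_degree v)%:R) * x v ^+ 2 by ring.
  have := cv v vL; have := pv v vL; move: (mu' - _) => p p0 pc.
  have h1 : 0 <= (b * S) ^+ 2 * (p * c v - 1) by rewrite mulr_ge0 ?sqr_ge0 ?subr_ge0.
  have h2 := sqr_ge0 (p * x v - b * S).
  rewrite -(ler_pM2l p0); lra.
(* [c v] is affine in the degree, so the sum of the degrees, at most [Lam * #|G|], suffices here. *)
have sumc : \sum_(v in ~: L) c v <=
    #|G|%:R / mu' + al * (Lam * #|G|%:R) / (mu' * (mu' - al * h)).
  have c0 v : 0 <= c v.
    by rewrite addr_ge0 ?divr_ge0 ?mulr_ge0 // ltW // ?mulr_gt0.
  apply: (@le_trans _ _ (\sum_v c v)).
    by rewrite [leRHS](sum_split_set L) lerDr sumr_ge0.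
  rewrite big_split /= sumr_const -[1 / mu' *+ _]mulr_natl div1r lerD2l.
  rewrite -mulr_suml -mulr_sumr; apply: ler_wpM2r.
    by rewrite invr_ge0 ltW // mulr_gt0.
  apply: ler_wpM2l; first exact: ltW.
  exact: sum_degree_le.
have cS : b ^+ 2 * S ^+ 2 * \sum_(v in ~: L) c v <= C * S ^+ 2.
  rewrite mulrAC; apply: ler_wpM2r; first exact: sqr_ge0.
  by apply: le_trans hC; apply: ler_wpM2l; rewrite ?sqr_ge0.
have yy' := ler_wpM2l (ltW b0) yy; have zz' := ler_wpM2l (ltW b0) zz.
have yz' := ler_wpM2l (ltW b0) yz.
have : mu' * Z = mu * Z - b * (Lam * Z) by rewrite /mu' mulrBl mulrA.
lra.
Qed.

(* [#|L| * sum x^2 - (sum x)^2] dominates [sum (x v - x v0)^2], by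
   Cauchy-Schwarz on the vertices other than [v0]. *)
Lemma sqr_sum_defect G (L : {set G}) (x : G -> R) (v0 : G) (kap A B : R) :
  v0 \in L -> 0 < kap -> 2 * #|L|%:R * kap <= A -> 2 * #|L|%:R * kap <= B ->
  kap * \sum_(v in L) x v ^+ 2 <=
  A * (#|L|%:R * \sum_(v in L) x v ^+ 2 - (\sum_(v in L) x v) ^+ 2) + B * x v0 ^+ 2.
Proof.
move=> v0L kap0 kA kB; set k := #|L|%:R.
have k1 : 1 <= k :> R by rewrite ler1n; apply/card_gt0P; exists v0.
rewrite !(bigD1 v0 v0L) /=.
set Y := \sum_(i in L | _) _; set S := \sum_(i in L | _) _; set x0 := x v0.
have S2 : S ^+ 2 <= (k - 1) * Y.
  have -> : k - 1 = #|[pred i | (i \in L) && (i != v0)]|%:R.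
    rewrite /k (cardsD1 v0 L) v0L natrD addrAC subrr add0r; congr _%:R.
    by apply: eq_card => i; rewrite !inE andbC.
  exact: sqr_sum_le.
set W := \sum_(i in L) (x i - x0) ^+ 2.
have WE : W = Y - 2 * x0 * S + (k - 1) * x0 ^+ 2.
  rewrite /W (bigD1 v0 v0L) /= subrr expr0n add0r.
  transitivity (\sum_(i in L | i != v0) (x i ^+ 2 - (2 * x0) * x i + x0 ^+ 2)).
    by apply: eq_bigr => i _; ring.
  rewrite big_split /= sumrB -mulr_sumr; congr (_ + _).
  transitivity (\sum_(i in L :\ v0) x0 ^+ 2).
    by apply: eq_bigl => i; rewrite !inE andbC.
  by rewrite sumr_const /k (cardsD1 v0 L) v0L natrD addrAC subrr add0r mulr_natl.
have W0 : 0 <= W by apply: sumr_ge0 => i _; apply: sqr_ge0.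
(* Pointwise x_i^2 <= 2 (x_i - x0)^2 + 2 x0^2, the difference being (x_i - 2 x0)^2. *)
have YW : x0 ^+ 2 + Y <= 2 * W + 2 * k * x0 ^+ 2.
  have h : 2 * W + 2 * k * x0 ^+ 2 - (x0 ^+ 2 + Y) = \sum_(i in L) (x i - 2 * x0) ^+ 2.
    transitivity (\sum_(i in L) (2 * (x i - x0) ^+ 2 + 2 * x0 ^+ 2 - x i ^+ 2)).
      rewrite sumrB big_split /= -mulr_sumr sumr_const -/W -[_ *+ #|L|]mulr_natl -/k.
      by rewrite (bigD1 v0 v0L) /= -/x0 -/Y; ring.
    by apply: eq_bigr => i _; ring.
  by rewrite -subr_ge0 h; apply: sumr_ge0 => i _; apply: sqr_ge0.
have A0 : 0 <= A by apply: le_trans kA; rewrite !mulr_ge0 ?ltW //; lra.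
have Wle : W <= k * (x0 ^+ 2 + Y) - (x0 + S) ^+ 2 by rewrite WE; lra.
have h1 := ler_wpM2l A0 Wle.
have h2 := ler_wpM2l (ltW kap0) YW.
have h3 := ler_wpM2r W0 kA.
have h4 := ler_wpM2r (sqr_ge0 x0) kB.
have h5 : 2 * kap * W <= 2 * k * kap * W.
  by rewrite -!mulrA ler_pM2l // mulrA ler_wpM2r // ?ler_peMl ?mulr_ge0 // ltW.
lra.
Qed.

(** Let S and Y be the sums of [x] and of its squares over [L]. It suffices to gain kap Y, which
    pays for tau S^2 <= k tau Y and for eta Y. If [#|L| < k], the gain comes from k Y - S^2 >= Y.
    Otherwise the degree missing at [v0] yields al x_{v0}^2, and [sqr_sum_defect] combines this with
    k Y - S^2. *)
Lemma high_degree_bound G (L : {set G}) (x : G -> R) (k : nat) (al mu C kap eta tau : R) :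
  0 < al < 1 -> (0 < k)%N -> 0 < kap ->
  2 * k%:R * kap <= al -> 2 * k%:R * kap <= (1 - al) / al ->
  k%:R * tau + eta <= kap -> 0 <= tau ->
  C = (1 - al) ^+ 2 / al + tau ->
  mu = al * (#|G|%:R - 1) + (1 - al) * (k%:R - 1) + k%:R * ((1 - al) ^+ 2 / al) - eta ->
  (#|L| <= k)%N -> (#|L| < k)%N \/ (exists2 v0, v0 \in L & ((vertex_degree v0).+1 < #|G|)%N) ->
  al * (\sum_(v in L) (vertex_degree v)%:R * x v ^+ 2)
    + (1 - al) * ((\sum_(v in L) x v) ^+ 2 - \sum_(v in L) x v ^+ 2)
    + C * (\sum_(v in L) x v) ^+ 2 <= mu * \sum_(v in L) x v ^+ 2.
Proof.
move=> /andP[al0 al1] k0 kap0 kal kbal ktau tau0 -> -> Lk hL.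
set b := 1 - al; have b0 : 0 < b by rewrite subr_gt0.
have bal : b + b ^+ 2 / al = b / al by rewrite /b; field; lra.
rewrite -/b in kbal; set c := b ^+ 2 / al in bal *.
set S := \sum_(v in L) x v; set Y := \sum_(v in L) x v ^+ 2.
have Y0 : 0 <= Y by apply: sumr_ge0 => v _; apply: sqr_ge0.
have S2 : S ^+ 2 <= #|L|%:R * Y by apply: sqr_sum_le.
have S2k : S ^+ 2 <= k%:R * Y.
  by apply: le_trans S2 _; apply: ler_wpM2r => //; rewrite ler_nat.
have tS := ler_wpM2l tau0 S2k.
have kY := ler_wpM2r Y0 ktau.
have k1 : 1 <= k%:R :> R by rewrite ler1n.
have deg_le (v : G) : (vertex_degree v)%:R <= #|G|%:R - 1 :> R.
  by rewrite lerBrDr natr1 ler_nat; exact: vertex_degree_lt.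
suff key : kap * Y + al * (\sum_(v in L) (vertex_degree v)%:R * x v ^+ 2) <=
    al * ((#|G|%:R - 1) * Y) + (b + c) * (k%:R * Y - S ^+ 2) by lra.
case: hL => [Llt | [v0 v0L dv0]].
  have d1 : \sum_(v in L) (vertex_degree v)%:R * x v ^+ 2 <= (#|G|%:R - 1) * Y.
    by rewrite mulr_sumr; apply: ler_sum => v _; apply: ler_wpM2r; rewrite ?sqr_ge0.
  have := ler_wpM2l (ltW al0) d1.
  have h : Y <= k%:R * Y - S ^+ 2.
    have : (#|L|%:R + 1) * Y <= k%:R * Y by apply: ler_wpM2r => //; rewrite natr1 ler_nat.
    lra.
  have bc0 : 0 <= b + c by rewrite bal divr_ge0 // ltW.
  have h2 := ler_wpM2l bc0 h.
  have h3 : kap * Y <= (b + c) * Y.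
    apply: ler_wpM2r => //; rewrite bal; apply: le_trans kbal.
    by rewrite ler_peMl ?ltW //; lra.
  lra.
have d1 : \sum_(v in L) (vertex_degree v)%:R * x v ^+ 2 <= (#|G|%:R - 1) * Y - x v0 ^+ 2.
  rewrite mulr_sumr /Y !(bigD1 v0 v0L) /= addrAC; apply: lerD.
    rewrite -[X in _ - X]mul1r -mulrBl; apply: ler_wpM2r; first exact: sqr_ge0.
    by rewrite !lerBrDr !natr1 ler_nat.
  by apply: ler_sum => v _; apply: ler_wpM2r; rewrite ?sqr_ge0.
have := ler_wpM2l (ltW al0) d1.
have lk2 B : 2 * k%:R * kap <= B -> 2 * #|L|%:R * kap <= B.
  by apply: le_trans; rewrite -!mulrA ler_pM2l // ler_pM2r // ler_nat.
rewrite -bal in kbal.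
have := sqr_sum_defect x v0L kap0 (lk2 _ kbal) (lk2 _ kal); rewrite -/Y -/S.
have bc0 : 0 <= b + c by rewrite bal divr_ge0 // ltW.
have LkY : #|L|%:R * Y <= k%:R * Y by apply: ler_wpM2r => //; rewrite ler_nat.
have := ler_wpM2l bc0 LkY.
lra.
Qed.

End HighDegree.

(** * Forcing k dominating vertices for large n *)

Section Structure.
Variable R : realType.
Implicit Types G : sgraph.

(** Test vector: 1 on [L], [s] elsewhere. Half of the cross term pays for the part of the norm lying
    off [L]; the other half is k^2 c up to O(1/n), that is k c after division by the norm k of the
    part on [L]. *)
Lemma lambda_join_lower G (L : {set G}) (k : nat) (al eta : R) :
  0 < al < 1 -> (0 < k)%N -> #|L| = k -> (forall v, v \in L -> dominating v) ->
  let b := 1 - al in let c := b ^+ 2 / al in 0 <= eta ->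
  k%:R ^+ 3 * c + (b * k%:R + k%:R * c) * (b * k%:R / al) ^+ 2 < k%:R * eta * #|G|%:R ->
  al * (#|G|%:R - 1) + b * (k%:R - 1) + k%:R * c - eta < lambda_ al G.
Proof.
move=> /andP[al0 al1] k0 Lk Ldom b c eta0 big; set mu := _ - eta.
have b0 : 0 < b by rewrite subr_gt0.
have c0 : 0 < c by rewrite divr_gt0 // exprn_gt0.
set n := #|G|%:R in big mu *.
have k1 : 1 <= k%:R :> R by rewrite ler1n.
have kn : k%:R <= n by rewrite ler_nat -Lk max_card.
have n0 : 0 < n by lra.
(* To leading order the eigenvalue equation off [L] reads al n s = b k. *)
pose s := b * k%:R / (al * n).
have s0 : 0 <= s by rewrite divr_ge0 // mulr_ge0 // ltW.
have sE : al * n * s = b * k%:R by rewrite /s; field; rewrite !gt_eqF.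
rewrite ltNge; apply/negP => lmu.
have al01 : 0 <= al <= 1 by rewrite !ltW.
have := le_trans (graph_form_join_ge al01 s0 Ldom) (graph_form_le _ _).
have -> : nrm2 (fun v => if v \in L then 1 else s) = k%:R + (n - k%:R) * s ^+ 2.
  rewrite /nrm2 (eq_bigr (fun v => if v \in L then 1 else s ^+ 2)) => [|v _].
    by rewrite sum_if_set Lk mulr1.
  by case: ifP; rewrite ?expr1n.
rewrite Lk -/n -/b => h.
set N := n - k%:R in h; have N0 : 0 <= N by rewrite subr_ge0.
have Ns0 : 0 <= N * s ^+ 2 by rewrite mulr_ge0 // sqr_ge0.
have h1 := ler_wpM2r (_ : 0 <= k%:R + N * s ^+ 2) lmu.
have {}h1 := le_trans h (h1 (addr_ge0 (ler0n _ _) Ns0)).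
have mule : mu * (N * s ^+ 2) <= (al * n + b * k%:R + k%:R * c) * (N * s ^+ 2).
  by apply: ler_wpM2r => //; rewrite /mu; lra.
have e1 : al * n * (N * s ^+ 2) = b * k%:R * (N * s) by rewrite -sE; ring.
have h2 : b * k%:R * (N * s) + k%:R * eta <=
    k%:R ^+ 2 * c + (b * k%:R + k%:R * c) * (N * s ^+ 2).
  have muk : mu * k%:R = al * (k%:R * (n - 1)) + b * (k%:R * (k%:R - 1)) + k%:R ^+ 2 * c - k%:R * eta.
    by rewrite /mu; ring.
  move: h1; rewrite [mu * _]mulrDr muk; lra.
have {}h2 := ler_wpM2r (ltW n0) h2.
have e2 : b * k%:R * (N * s) * n = k%:R ^+ 2 * c * N.
  have -> : b * k%:R * (N * s) * n = b * k%:R * N * (al * n * s) / al by field; rewrite gt_eqF.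
  by rewrite sE /c; field; rewrite gt_eqF.
have h3 : N * s ^+ 2 * n <= (b * k%:R / al) ^+ 2.
  have -> : (b * k%:R / al) ^+ 2 = n * s ^+ 2 * n by rewrite -sE; field; rewrite gt_eqF.
  apply: ler_wpM2r; first exact: ltW.
  by apply: ler_wpM2r; [exact: sqr_ge0|rewrite /N; lra].
have bkc : 0 <= b * k%:R + k%:R * c by rewrite addr_ge0 // mulr_ge0 // ltW.
have {}h3 := ler_wpM2l bkc h3.
have e3 : k%:R ^+ 2 * c * N = k%:R ^+ 2 * c * n - k%:R ^+ 3 * c by rewrite /N; ring.
lra.
Qed.

Lemma dominating_of_degree G (v : G) : (#|G| <= (vertex_degree v).+1)%N -> dominating v.
Proof.
move=> dv w wv; have /eqP NE : [set u | edge v u]%SET == [set~ v]%SET.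
  rewrite eqEcard cardsC1; apply/andP; split.
    by apply/fintype.subsetP => u; rewrite !inE => vu; apply/eqP => uv; rewrite uv edge_irr in vu.
  by rewrite -ltnS (leq_trans _ dv) // prednK //; apply/card_gt0P; exists v.
by have := finset.in_setC1 w v; rewrite -NE inE wv.
Qed.

Lemma exists_subset_card (T : finType) (A : {set T}) m : (m <= #|A|)%N ->
  exists2 B : {set T}, B \subset A & #|B| = m.
Proof.
move=> mA; exists [set x in take m (enum A)]%SET.
  by apply/fintype.subsetP => x; rewrite inE => /mem_take; rewrite mem_enum.
rewrite cardsE (card_uniqP _) ?take_uniq ?enum_uniq //.
by rewrite size_takel // -cardE.
Qed.

(** All numerical requirements are gathered here for a single graph. [few_high_degrees] leaves at
    most [k] vertices of degree at least [h]; if they are fewer, or one is not dominating,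
    [graph_form_upper] off that set and [high_degree_bound] on it give [lambda_ al G <= mu]. *)
Lemma exists_dominating_set G (k : nat) (al h mu C kap eta tau : R) :
  let Lam := Num.sqrt (k%:R * #|G|%:R) + k%:R in
  let b := 1 - al in let mu' := mu - b * Lam in
  0 < al < 1 -> (0 < k)%N -> (0 < #|G|)%N ->
  (forall x : G -> R, (forall v, 0 <= x v) -> adjform x x <= Lam * nrm2 x) ->
  0 <= h - k%:R -> Lam * #|G|%:R < Num.sqrt (k.+1%:R * #|G|%:R) * (h - k%:R) ->
  0 < mu' -> 0 < mu' - al * h ->
  b ^+ 2 * (#|G|%:R / mu' + al * (Lam * #|G|%:R) / (mu' * (mu' - al * h))) <= C ->
  0 < kap -> 2 * k%:R * kap <= al -> 2 * k%:R * kap <= b / al ->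
  k%:R * tau + eta <= kap -> 0 <= tau -> C = b ^+ 2 / al + tau ->
  mu = al * (#|G|%:R - 1) + b * (k%:R - 1) + k%:R * (b ^+ 2 / al) - eta ->
  mu < lambda_ al G ->
  exists2 L : {set G}, #|L| = k & forall v, v \in L -> dominating v.
Proof.
move=> Lam b mu' al01 k0 G0 GLam hk hLam mu'0 mu'h hC kap0 kal kbal ktau tau0 CE muE mulam.
pose L := [set v : G | h <= (vertex_degree v)%:R]%SET.
have Lk : (#|L| <= k)%N.
  rewrite leqNgt; apply/negP => /exists_subset_card[L' /fintype.subsetP L'L L'k].
  have degL' v : v \in L' -> h <= (vertex_degree v)%:R by move=> /L'L; rewrite inE.
  by have := few_high_degrees GLam G0 hk degL' L'k; rewrite leNgt hLam.
have degL v : v \notin L -> (vertex_degree v)%:R <= h.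
  by rewrite inE -ltNge => /ltW.
have al1 : al <= 1 by case/andP: al01 => _ /ltW.
have [x [x0 xn xe]] := perron_vector al1 G0.
have := graph_form_upper al01 x0 GLam degL mu'0 mu'h hC.
rewrite (perron_form xe) => up.
have not_small : ~ ((#|L| < k)%N \/
    exists2 v0, v0 \in L & ((vertex_degree v0).+1 < #|G|)%N).
  move=> hL; have := high_degree_bound x al01 k0 kap0 kal kbal ktau tau0 CE muE Lk hL.
  move=> low; have : lambda_ al G * nrm2 x <= mu * nrm2 x.
    by rewrite {2}/nrm2 (sum_split_set L) mulrDr; lra.
  by rewrite ler_pM2r // leNgt mulam.
exists L; first by apply/eqP; rewrite eqn_leq Lk leqNgt; apply/negP => ?; apply: not_small; left.
move=> v vL; apply: dominating_of_degree; rewrite leqNgt; apply/negP => ?.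
by apply: not_small; right; exists v.
Qed.

(** Once r = sqrt n is at least [r0], A r >= A + |B| + |C|; multiply by r >= 1. *)
Lemma near_sqrt_quadratic (A B C : R) : 0 < A ->
  \forall n \near \oo, B * Num.sqrt n%:R + C < A * Num.sqrt n%:R ^+ 2.
Proof.
move=> A0; pose r0 := 1 + (`|B| + `|C|) / A.
have r01 : 1 <= r0 by rewrite lerDl divr_ge0 ?addr_ge0 // ltW.
near=> n; set r := Num.sqrt _.
have rr : r0 <= r.
  have r2 : r0 ^+ 2 <= n%:R by near: n; apply: nbhs_infty_ger.
  by rewrite -(ler_pXn2r (n := 2)) ?nnegrE ?sqrtr_ge0 // ?sqr_sqrtr //; lra.
have Ar : A + `|B| + `|C| <= A * r.
  have -> : A + `|B| + `|C| = A * r0 by rewrite /r0; field; rewrite gt_eqF.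
  by rewrite ler_pM2l.
have r1 : 1 <= r by lra.
have h := ler_wpM2r (_ : 0 <= r) Ar.
have {}h := h (le_trans ler01 r1).
have Br : B * r <= `|B| * r by apply: ler_wpM2r; [lra|exact: ler_norm].
have Cr : C <= `|C| * r by apply: le_trans (ler_norm _) _; rewrite ler_peMr.
have : 0 < A * r by rewrite mulr_gt0 //; lra.
rewrite expr2 mulrA; lra.
Unshelve. all: by end_near.
Qed.

(* With [r = sqrt n], every requirement of [exists_dominating_set] and
   [lambda_join_lower] is an inequality [B r + C < A r^2]. *)
Lemma near_dominating_set (k : nat) (al : R) : 0 < al < 1 -> (0 < k)%N ->
  \forall n \near \oo, forall G G' (L' : {set G'}), #|G| = n -> #|G'| = n ->
    #|L'| = k -> (forall v, v \in L' -> dominating v) ->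
    (forall x : G -> R, (forall v, 0 <= x v) ->
       adjform x x <= (Num.sqrt (k%:R * n%:R) + k%:R) * nrm2 x) ->
    lambda_ al G' <= lambda_ al G ->
  exists2 L : {set G}, #|L| = k & forall v, v \in L -> dominating v.
Proof.
move=> al01 k0; have /andP[al0 al1] := al01.
pose b := 1 - al; have b0 : 0 < b by rewrite subr_gt0.
have b1 : b <= 1 by rewrite /b; lra.
pose c := b ^+ 2 / al; have c0 : 0 < c by rewrite divr_gt0 // exprn_gt0.
have k1 : 1 <= k%:R :> R by rewrite ler1n.
have kp : 0 < k%:R :> R by lra.
(* The largest value allowed by both upper bounds on [kap]; [eta] and [k * tau] then take half of it
   each. *)
pose kap := Num.min al (b / al) / (2 * k%:R).
have kap0 : 0 < kap.
  by rewrite divr_gt0 ?mulr_gt0 // lt_min al0 divr_gt0.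
have kapE : 2 * k%:R * kap = Num.min al (b / al) by rewrite /kap; field; rewrite gt_eqF.
have kal : 2 * k%:R * kap <= al by rewrite kapE ge_min lexx.
have kbal : 2 * k%:R * kap <= b / al by rewrite kapE ge_min lexx orbT.
pose eta := kap / 2; pose tau := kap / (2 * k%:R).
have eta0 : 0 < eta by rewrite divr_gt0.
have tau0 : 0 < tau by rewrite divr_gt0 // mulr_gt0.
have ktau : k%:R * tau + eta <= kap.
  have -> : k%:R * tau = kap / 2 by rewrite /tau; field; rewrite gt_eqF.
  by rewrite /eta; lra.
pose K1 := Num.sqrt (k%:R : R); pose K2 := Num.sqrt (k.+1%:R : R).
have K10 : 0 < K1 by rewrite sqrtr_gt0.
have K12 : K1 < K2 by rewrite ltr_sqrt ?ltr0n // ltr_nat.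
(* Between K1 / K2 and 1: [K2 * th > K1] limits the number of vertices of degree at least th n, and
   [th < 1] keeps mu' - al th n of order n. *)
pose th := (K1 + K2) / (2 * K2).
have K20 : 0 < K2 by lra.
have thE : K2 * th = (K1 + K2) / 2 by rewrite /th; field; rewrite gt_eqF.
have th1 : th < 1 by rewrite ltr_pdivrMr ?mulr_gt0 //; lra.
have th0 : 0 < th by rewrite divr_gt0 ?mulr_gt0 // addr_gt0.
pose M := - al + b * (k%:R - 1) + k%:R * c - eta.
pose e1 := al * (1 - th) / 2.
have e10 : 0 < e1 by rewrite divr_gt0 // mulr_gt0 // subr_gt0.
(* Two error terms of size [del] make up the slack [tau]. *)
pose del := tau / 2; have del0 : 0 < del by rewrite divr_gt0.
pose rt (n : nat) : R := Num.sqrt n%:R.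
near=> n.
(* In turn: n > 1; mu' - al th n >= e1 n; n / mu' <= 1 / al + del; the degree correction is at most
   [del]; the hypothesis excluding k + 1 vertices of high degree; that of [lambda_join_lower]; k <
   th n. *)
have C0 : 0 * rt n + 1 < 1 * rt n ^+ 2 by near: n; apply: near_sqrt_quadratic.
have C1 : b * K1 * rt n + (b * k%:R - M) < e1 * rt n ^+ 2.
  by near: n; apply: near_sqrt_quadratic.
have C2 : b * K1 / al * rt n + (b * k%:R - M) / al < del * al / 2 * rt n ^+ 2.
  by near: n; apply: near_sqrt_quadratic; rewrite divr_gt0 // mulr_gt0.
have C3 : (2 * (K1 + k%:R) / (e1 * del)) * rt n + 0 < 1 * rt n ^+ 2.
  by near: n; apply: near_sqrt_quadratic.
have C4 : k%:R * rt n + K2 * k%:R < (K2 - K1) / 2 * rt n ^+ 2.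
  by near: n; apply: near_sqrt_quadratic; rewrite divr_gt0 // subr_gt0.
have C5 : 0 * rt n + (k%:R ^+ 3 * c + (b * k%:R + k%:R * c) * (b * k%:R / al) ^+ 2) <
    k%:R * eta * rt n ^+ 2.
  by near: n; apply: near_sqrt_quadratic; rewrite mulr_gt0.
have C6 : 0 * rt n + k%:R < th * rt n ^+ 2.
  by near: n; apply: near_sqrt_quadratic.
move=> G G' L' Gn G'n L'k L'dom GLam lGG'.
set r := rt n in C0 C1 C2 C3 C4 C5 C6.
have r2 : r ^+ 2 = n%:R by rewrite sqr_sqrtr.
have r1 : 1 < r ^+ 2 by lra.
have r0 : 0 < r by rewrite lt_neqAle sqrtr_ge0 andbT eq_sym -sqrf_eq0 gt_eqF //; lra.
rewrite mul0r add0r in C5; rewrite mul0r add0r in C6.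
have n0 : (0 < n)%N by rewrite -(ltr_nat R) -r2; lra.
pose mu := al * (n%:R - 1) + b * (k%:R - 1) + k%:R * c - eta.
have muE : mu = al * r ^+ 2 + M by rewrite /mu /M r2; ring.
have mulam : mu < lambda_ al G.
  apply: lt_le_trans lGG'; rewrite /mu -G'n.
  apply: (lambda_join_lower al01 k0 L'k L'dom (ltW eta0)).
  by rewrite G'n -r2.
have LamE : Num.sqrt (k%:R * n%:R) + k%:R = K1 * r + k%:R by rewrite sqrtrM.
have K2E : Num.sqrt (k.+1%:R * n%:R) = K2 * r by rewrite sqrtrM.
have n_r : n%:R = r ^+ 2 :> R by rewrite r2.
pose mu' := mu - b * (K1 * r + k%:R).
have mu'h : e1 * r ^+ 2 <= mu' - al * (th * r ^+ 2).
  by rewrite /mu' muE; move: C1; rewrite /e1; lra.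
have mu'2 : al / 2 * r ^+ 2 <= mu'.
  have : 0 <= al * th * r ^+ 2.
    apply: mulr_ge0; last exact: sqr_ge0.
    by apply: ltW; apply: mulr_gt0.
  by move: mu'h; rewrite /e1; lra.
have r20 : 0 < r ^+ 2 by lra.
have al20 : 0 < al / 2 by rewrite divr_gt0.
have mu'0 : 0 < mu' by apply: lt_le_trans mu'2; rewrite mulr_gt0.
have mu'h0 : 0 < mu' - al * (th * r ^+ 2) by apply: lt_le_trans mu'h; rewrite mulr_gt0.
apply: (@exists_dominating_set G k al (th * r ^+ 2) mu (c + tau) kap eta tau);
  rewrite ?Gn ?LamE ?K2E // ?n_r -/b ?(ltW tau0) //.
- by move: GLam; rewrite LamE.
- by rewrite subr_ge0 ltW.
- rewrite mulrAC -subr_gt0.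
  have -> : K2 * (th * r ^+ 2 - k%:R) * r - (K1 * r + k%:R) * r ^+ 2 =
    r * (K2 * th * r ^+ 2 - K2 * k%:R - (K1 * r ^+ 2 + k%:R * r)) by ring.
  by rewrite thE mulr_gt0 //; lra.
- have X : r ^+ 2 / mu' <= al^-1 + del.
    rewrite ler_pdivrMr // mulrDl.
    have h1 : al^-1 * mu' = r ^+ 2 - (b * K1 / al * r + (b * k%:R - M) / al).
      by rewrite /mu' muE; field; rewrite gt_eqF.
    have := ler_wpM2l (ltW del0) mu'2; rewrite h1; lra.
  (* The numerator is O(n^(3/2)), while the denominator is at least a constant times n^2. *)
  have Y : al * ((K1 * r + k%:R) * r ^+ 2) / (mu' * (mu' - al * (th * r ^+ 2))) <= del.
    rewrite ler_pdivrMr ?mulr_gt0 //.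
    have h1 : al / 2 * r ^+ 2 * (e1 * r ^+ 2) <= mu' * (mu' - al * (th * r ^+ 2)).
      by apply: ler_pM => //; apply: ltW; apply: mulr_gt0.
    apply: le_trans (ler_wpM2l (ltW del0) h1).
    have h2 : 2 * (K1 + k%:R) * r <= e1 * del * r ^+ 2.
      have := ltW C3; rewrite addr0 mul1r mulrAC ler_pdivrMr ?(mulr_gt0 e10 del0) //; lra.
    have h3 : K1 * r + k%:R <= (K1 + k%:R) * r.
      have : 1 <= r by rewrite -(ler_pXn2r (n := 2)) ?nnegrE ?expr1n // ltW.
      by rewrite mulrDl lerD2l => /(ler_peMr (ltW kp)).
    rewrite -subr_ge0.
    have -> : del * (al / 2 * r ^+ 2 * (e1 * r ^+ 2)) - al * ((K1 * r + k%:R) * r ^+ 2) =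
      al * r ^+ 2 * ((e1 * del * r ^+ 2) / 2 - (K1 * r + k%:R)) by field.
    by rewrite mulr_ge0 ?mulr_ge0 ?(ltW al0) ?(ltW r20) //; lra.
  have b2 : b ^+ 2 <= 1 by rewrite expr_le1 // ltW.
  have h := ler_wpM2l (sqr_ge0 b) (lerD X Y).
  apply: le_trans h _; rewrite -addrA mulrDr lerD2l.
  have -> : del + del = tau by rewrite /del; lra.
  by rewrite ler_piMl // ltW.
Unshelve. all: by end_near.
Qed.

End Structure.

(** * Comparing graphs with k dominating vertices, and the conclusion *)

Section Assembly.
Variable R : realType.
Implicit Types (G H Y : sgraph).

(** Moves the join structure into [H]: [L] corresponds to the clique and [h] embeds [Y] as the
    rest. *)
Lemma isomorphic_join H Y k : isomorphic H (graph_join (complete_graph k) Y) ->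
  exists (L : {set H}) (h : Y -> H),
    [/\ #|L| = k, forall v, v \in L -> dominating v,
        forall v, v \notin L -> exists y, v = h y, forall y, h y \notin L
      & forall y z, edge (h y) (h z) = edge y z].
Proof.
case=> f fb fe; have [g fK gK] := fb.
pose A : {set graph_join (complete_graph k) Y} := [set inl i | i in [set: 'I_k]]%SET.
have inA u : (u \in A) = if u is inl _ then true else false.
  case: u => [i|y]; first by apply/finset.imsetP; exists i; rewrite ?finset.in_setT.
  by apply/negbTE/finset.imsetP => -[].
exists (f @^-1: A)%SET, (fun y => g (inr y)); split.
- rewrite on_card_preimset; last exact: onW_bij.
  by rewrite card_imset ?cardsT ?card_ord // => i j [].
- move=> v; rewrite inE inA => fv w wv; rewrite -fe.
  have : f w != f v by rewrite (inj_eq (bij_inj fb)).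
  by move: fv; case: (f v) => // i _; case: (f w) => //= j; rewrite /edge /= eq_sym.
- by move=> v; rewrite inE inA; case fv: (f v) => [//|y] _; exists y; rewrite -fv fK.
- by move=> y; rewrite inE inA gK.
- by move=> y z; rewrite -fe !gK.
Qed.

(** Any bijection carrying [L] onto [M] works: each edge of [G] has an end in [L], whose image is
    dominating. *)
Lemma join_hom G H (L : {set G}) (M : {set H}) :
  #|G| = #|H| -> #|L| = #|M| -> (forall v, v \in M -> dominating v) ->
  (forall v w, v \notin L -> w \notin L -> ~~ edge v w) ->
  exists2 f : G -> H, bijective f & forall v w, edge v w -> edge (f v) (f w).
Proof.
move=> GH LM Mdom Lind.
have [|f fb fc] := @colour_bij G H bool (mem L) (mem M).
  have setE (T : finType) (A : {set T}) b :
      [set x | mem A x == b]%SET = if b then A else ~: A.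
    by apply/setP => x; rewrite !inE; case: b; rewrite ?inE /= ?eqb_id // eqbF_neg.
  move=> b; rewrite !setE; case: b => //.
  by apply/eqP; rewrite -(eqn_add2l #|L|) cardsC LM cardsC GH.
have fM v : (f v \in M) = (v \in L) := fc v.
exists f => // v w vw.
have fvw : f w != f v.
  by rewrite (inj_eq (bij_inj fb)); apply: contraL vw => /eqP ->; rewrite edge_irr.
have [vL|vL] := boolP (v \in L); first by apply: Mdom; rewrite ?fM.
have [wL|wL] := boolP (w \in L); first by rewrite edge_sym; apply: Mdom; rewrite ?fM // eq_sym.
by move: (Lind v w vL wL); rewrite vw.
Qed.

(** The only possible edge of [G] off [L] is [p q], so it is enough to carry [L] onto [M] and the
    pair [p], [q] onto the ends of the edge [u t]. *)
Lemma join_edge_hom G H (L : {set G}) (M : {set H}) (p q : G) (u t : H) :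
  #|G| = #|H| -> #|L| = #|M| -> (forall v, v \in M -> dominating v) ->
  p \notin L -> q \notin L -> p != q ->
  (forall v w, v \notin L -> w \notin L -> edge v w -> (v \in [set p; q]) && (w \in [set p; q]))%SET ->
  u \notin M -> t \notin M -> edge u t ->
  exists2 f : G -> H, bijective f & forall v w, edge v w -> edge (f v) (f w).
Proof.
move=> GH LM Mdom pL qL pq Lpq uM tM ut.
have ut_neq : u != t by apply: contraL ut => /eqP ->; rewrite edge_irr.
(* [None] marks [A]; elsewhere the colour records membership in [B], the chosen pair. *)
pose col (T : finType) (A B : {set T}) (x : T) : option bool :=
  if x \in A then None else Some (x \in B).
have colN (T : finType) (A B : {set T}) : [set x | col T A B x == None]%SET = A.
  by apply/setP => x; rewrite inE /col; case: ifP.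
have colT (T : finType) (A : {set T}) (x y : T) : x \notin A -> y \notin A ->
    [set z | col T A [set x; y]%SET z == Some true]%SET = [set x; y]%SET.
  move=> xA yA; apply/setP => z; rewrite inE /col; case: ifP => zA.
    by rewrite !inE; apply/esym/negbTE/negP => /orP[]/eqP zE; move: xA yA; rewrite -zE zA.
  by rewrite (inj_eq Some_inj) eqb_id.
have colF (T : finType) (A : {set T}) (x y : T) : x \notin A -> y \notin A -> x != y ->
    (#|A| + (2 + #|[set z | col T A [set x; y]%SET z == Some false]%SET|) = #|T|)%N.
  move=> xA yA xy; rewrite -(cardsC A); congr addn.
  rewrite -(cardsID [set x; y]%SET (~: A)); congr addn.
    have /finset.setIidPr -> : [set x; y]%SET \subset ~: A; last by rewrite cards2 xy.
    by apply/fintype.subsetP => z; rewrite !inE => /orP[]/eqP ->.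
  apply: eq_card => z; rewrite !inE /col andbC; case: ifP => //= _.
  by rewrite (inj_eq Some_inj) eqbF_neg !inE.
have [|f fb fc] := @colour_bij G H _ (col G L [set p; q]%SET) (col H M [set u; t]%SET).
  case=> [[]|].
  - by rewrite !colT // !cards2 pq ut_neq.
  - apply/eqP; rewrite -(eqn_add2l 2) -(eqn_add2l #|L|) colF // LM colF //.
    by rewrite GH.
  - by rewrite !colN.
have fM v : (f v \in M) = (v \in L).
  by have := fc v; rewrite /col; case: ifP; case: ifP.
have fB v : v \notin L -> (f v \in [set u; t]%SET) = (v \in [set p; q]%SET).
  by move=> vL; have := fc v; rewrite /col fM (negbTE vL) => -[].
exists f => // v w vw.
have fvw : f w != f v.
  by rewrite (inj_eq (bij_inj fb)); apply: contraL vw => /eqP ->; rewrite edge_irr.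
have [vL|vL] := boolP (v \in L); first by apply: Mdom; rewrite ?fM.
have [wL|wL] := boolP (w \in L); first by rewrite edge_sym; apply: Mdom; rewrite ?fM // eq_sym.
have /andP[] := Lpq v w vL wL vw; rewrite -!fB // !inE.
move=> /orP[]/eqP vE /orP[]/eqP wE; rewrite vE wE ?eqxx // in fvw *.
by rewrite edge_sym.
Qed.

Lemma lambda0_join_le H (L : {set H}) k : (0 < k)%N -> #|L| = k ->
  (forall v, v \notin L -> #|[set w | edge v w & w \notin L]%SET| <= 1)%N ->
  lambda_ 0 H <= Num.sqrt (k%:R * #|H|%:R) + k%:R :> R.
Proof.
move=> k0 Lk hL.
have H0 : (0 < #|H|)%N by rewrite (leq_trans _ (max_card (mem L))) // Lk.
have [x [x0 xn xe]] := @perron_vector R 0 H ler01 H0.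
rewrite -(ler_pM2r xn) -(perron_form xe) /graph_form mul0r add0r subr0 mul1r.
exact: (adjform_join_le k0 Lk hL x0).
Qed.

(** If [H] has no edge off [M], or [G] has an edge off [L], then [H] maps into [G] and the
    comparison of [lambda_ 0] applies. Otherwise [G] maps into [H], and the comparison of
    [lambda_ al] applies in the opposite direction. *)
Lemma spex_rigid k (al : R) (G H : sgraph) (L : {set G}) : (0 < k)%N -> 0 < al < 1 ->
  #|G| = #|H| -> #|L| = k -> (forall v, v \in L -> dominating v) ->
  lambda_ al H <= lambda_ al G -> lambda_ 0 G <= lambda_ 0 H :> R ->
  forall M : {set H}, #|M| = k -> (forall v, v \in M -> dominating v) ->
  (forall v w, v \notin M -> w \notin M -> ~~ edge v w) \/
  (exists p q : H, [/\ p \notin M, q \notin M, p != q &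
     forall v w, v \notin M -> w \notin M -> edge v w ->
       (v \in [set p; q]%SET) && (w \in [set p; q]%SET)]) ->
  isomorphic G H.
Proof.
move=> k0 /andP[al0 al1] GH Lk Ldom lal l0 M Mk Mdom.
have LM : #|L| = #|M| by rewrite Lk Mk.
have al01 : 0 <= al < 1 by rewrite ltW.
have z01 : 0 <= (0 : R) < 1 by rewrite lexx ltr01.
have /card_gt0P[m mM] : (0 < #|M|)%N by rewrite Mk.
have /card_gt0P[l lL] : (0 < #|L|)%N by rewrite Lk.
case=> [Mind | [p [q [pM qM pq Mpq]]]].
  have [f fb fe] := join_hom (esym GH) (esym LM) Ldom Mind.
  by apply/isomorphic_sym/(hom_isomorphic z01 (Mdom m mM) fb fe).
have [/existsP[u /existsP[t /and3P[uL tL ut]]] | nut] :=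
  boolP [exists u, exists t, [&& u \notin L, t \notin L & edge u t]].
  have [f fb fe] := join_edge_hom (esym GH) (esym LM) Ldom pM qM pq Mpq uL tL ut.
  by apply/isomorphic_sym/(hom_isomorphic z01 (Mdom m mM) fb fe).
have Lind v w : v \notin L -> w \notin L -> ~~ edge v w.
  move=> vL wL; apply: contra nut => vw.
  by apply/existsP; exists v; apply/existsP; exists w; rewrite vL wL.
have [f fb fe] := join_hom GH LM Mdom Lind.
exact: (hom_isomorphic al01 (Ldom l lL) fb fe).
Qed.

(** A common description of both shapes of [H]: at most one edge avoids the dominating set [M]. The
    third clause feeds the bound on [lambda_ 0], the fourth feeds [spex_rigid]. *)
Lemma join_cases H k n :
  isomorphic H (graph_join (complete_graph k) (graph_compl (complete_graph (n - k)))) \/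
  isomorphic H (graph_join (complete_graph k)
    (disjoint_union (complete_graph 2) (graph_compl (complete_graph (n - k - 2))))) ->
  exists M : {set H}, [/\ #|M| = k, forall v, v \in M -> dominating v,
    forall v, (v \notin M -> #|[set w | edge v w & w \notin M]%SET| <= 1)%N &
    (forall v w, v \notin M -> w \notin M -> ~~ edge v w) \/
    (exists p q : H, [/\ p \notin M, q \notin M, p != q &
       forall v w, v \notin M -> w \notin M -> edge v w ->
         (v \in [set p; q]%SET) && (w \in [set p; q]%SET)])].
Proof.
case=> /isomorphic_join[M [h [Mk Mdom Mh hM he]]]; exists M.
  have ind v w : v \notin M -> w \notin M -> ~~ edge v w.
    move=> /Mh[y ->] /Mh[z ->]; rewrite he.
    by rewrite /edge /= /compl_edge /edge /= andbN.
  split=> //; last by left.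
  move=> v vM; rewrite (_ : [set w | _]%SET = finset.set0) ?cards0 //.
  by apply/setP => w; rewrite !inE; apply/negP => /andP[vw wM]; move: (ind v w vM wM); rewrite vw.
pose p := h (inl ord0); pose q := h (inl ord_max).
have epq v w : v \notin M -> w \notin M -> edge v w ->
    (v = p /\ w = q) \/ (v = q /\ w = p).
  move=> /Mh[y ->] /Mh[z ->]; rewrite he.
  case: y z => [i|y] [j|z] //; last by rewrite /edge /= /compl_edge /edge /= andbN.
  rewrite /edge /= /edge /=; case: i => [[|[|//]] hi]; case: j => [[|[|//]] hj] //= _.
    by left; rewrite /p /q; split; congr (h (inl _)); apply/val_inj.
  by right; rewrite /p /q; split; congr (h (inl _)); apply/val_inj.
have pq : p != q.
  have : edge p q by rewrite he.
  by apply: contraL => /eqP ->; rewrite edge_irr.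
split=> //.
- move=> v vM; apply/card_le1_eqP => w w'; rewrite !inE => /andP[vw wM] /andP[vw' w'M].
  have [[vE ->]|[vE ->]] := epq _ _ vM wM vw; have [[vE' ->]|[vE' ->]] := epq _ _ vM w'M vw' => //.
    by move: pq; rewrite -vE -vE' eqxx.
  by move: pq; rewrite -vE -vE' eqxx.
- right; exists p, q; split=> [|||v w vM wM vw]; rewrite ?hM // !inE.
  by have [[-> ->]|[-> ->]] := epq _ _ vM wM vw; rewrite !eqxx ?orbT.
Qed.

End Assembly.

Theorem theorem1p5 (R : realType) (F : graph_family)
  (hF : (exists F0 : sgraph, [/\ F F0, bipartite F0 &
           exists v : F0, forest (delete_vertex v)]) \/
        (fun n : nat => (ex_number n F)%:R : R^o) =O_\oo (fun n : nat => n%:R : R^o))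
  (k : nat) (hk : (1 <= k)%N)
  (H : nat -> sgraph)
  (hH : \forall n \near \oo, SPEX R n F (H n) /\
     (isomorphic (H n) (graph_join (complete_graph k) (graph_compl (complete_graph (n - k)))) \/
      isomorphic (H n)
        (graph_join (complete_graph k)
          (disjoint_union (complete_graph 2) (graph_compl (complete_graph (n - k - 2)))))))
  (alpha : R) (halpha : 0 < alpha < 1) :
  \forall n \near \oo, forall G : sgraph, SPEX_ alpha n F G <-> isomorphic G (H n).
Proof.
apply: filterS (filterI hH (near_dominating_set halpha hk)).
move=> n [[[Hn Hfree Hmax] /join_cases[M [Mk Mdom M1 Mcases]]] domn].
have al01 : 0 <= alpha <= 1 by case/andP: halpha => /ltW -> /ltW ->.
have n0 : (0 < n)%N by rewrite -Hn (leq_trans _ (max_card (mem M))) // Mk.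
(* A weak inequality suffices to identify a competitor with [H n]; this yields uniqueness and also
   the maximality of [H n]. *)
have core (G : sgraph) : #|G| = n -> family_free F G ->
    lambda_ alpha (H n) <= lambda_ alpha G -> isomorphic G (H n).
  move=> Gn Gfree lHG; have lG := Hmax G Gn Gfree.
  have [|L Lk Ldom] := domn G (H n) M Gn Hn Mk Mdom _ lHG.
    (* The form is at most [lambda_ 0 G] times the squared norm, and
       [lambda_ 0 G <= lambda_ 0 (H n)] by maximality of [H n]. *)
    move=> x _; have := graph_form_le 0 x.
    rewrite /graph_form mul0r add0r subr0 mul1r => /le_trans; apply.
    apply: ler_wpM2r; first exact: nrm2_ge0.
    by apply: le_trans lG _; have := lambda0_join_le R hk Mk M1; rewrite Hn.
  by apply: (spex_rigid hk halpha _ Lk Ldom lHG lG Mk Mdom Mcases); rewrite Gn Hn.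
move=> G; split=> [[Gn Gfree Gmax]|iGH].
  by apply: core => //; apply: Gmax.
have Gn : #|G| = n by rewrite (isomorphic_card iGH).
have lGH : lambda_ alpha G = lambda_ alpha (H n).
  by apply: lambda_iso => //; rewrite Gn.
split=> //; first exact: isomorphic_family_free iGH Hfree.
(* A competitor with strictly larger value would be isomorphic to [H n] by [core], hence have the
   same value. *)
move=> G' G'n G'free; rewrite lGH leNgt; apply/negP => lt.
have := lambda_iso al01 _ (core G' G'n G'free (ltW lt)); rewrite G'n => /(_ n0) h.
by rewrite h ltxx in lt.
Qed.
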